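(* Let $\mathcal{X},\mathcal{Y}$ be finite alphabets, let $\mathcal{H}$ be a finite-dimensional complex Hilbert space, and consider the discrete memoryless classical-classical-quantum (DM-CCQ) channel generated by a map $W:\mathcal{X}\times\mathcal{Y}\to\mathcal{S}(\mathcal{H})$. Let $C(W)$ be its message transmission capacity region (average error criterion) and $C_{\mathrm{id}}^{\mathrm{sim}}(W)$ its simultaneous identification capacity region. Then $$C(W)=C_{\mathrm{id}}^{\mathrm{sim}}(W).$$
   Context: $\mathcal{S}(\mathcal{H})$ denotes the set of quantum states (density operators) on $\mathcal{H}$, $\mathcal{L}(\mathcal{H})$ the linear operators on $\mathcal{H}$, $\mathcal{P}(A)$ the set of probability distributions on a finite set $A$, and $[M]=\{1,\dots,M\}$. Logarithms are to base 2. A POVM is a finite family of positive semidefinite operators summing to the identity. A CCQ channel $\mathbf{W}$ is a family of maps $\{W^k:\mathcal{X}^k\times\mathcal{Y}^k\to\mathcal{S}(\mathcal{H}^{\otimes k})\}_{k\in\mathbb{N}}$. It is the DM-CCQ channel generated by $W:\mathcal{X}\times\mathcal{Y}\to\mathcal{S}(\mathcal{H})$ if $W^k(x^k,y^k)=\bigotimes_{i=1}^k W(x_i,y_i)$ for all $k$, $x^k\in\mathcal{X}^k$, $y^k\in\mathcal{Y}^k$; in that case it is denoted simply by $W$. Transmission. A $(k,M,N)$-code for $\mathbf{W}$ is a family $\mathcal{C}=(x_m,y_n,D_{mn})_{m=1,n=1}^{M,N}$ with $x_1,\dots,x_M\in\mathcal{X}^k$, $y_1,\dots,y_N\in\mathcal{Y}^k$,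 and $\{D_{mn}\}_{m,n}\subset\mathcal{L}(\mathcal{H}^{\otimes k})$ a POVM. Its average error is $\overline{e}(\mathcal{C},W^k)=1-\frac{1}{MN}\sum_{m=1}^M\sum_{n=1}^N\mathrm{tr}(D_{mn}W^k(x_m,y_n))$. A pair $(R_1,R_2)\in\mathbb{R}^2$ with $R_1,R_2\ge 0$ is an achievable rate pair if for all $\epsilon,\delta>0$ there is $k_0$ such that for all $k\ge k_0$ there is a $(k,M,N)$-code $\mathcal{C}$ with $\frac1k\log M\ge R_1-\delta$, $\frac1k\log N\ge R_2-\delta$, $\overline{e}(\mathcal{C},W^k)\le\epsilon$. $C(\mathbf{W})$ is the set of all achievable rate pairs. Identification. A $(k,M,N)$-ID-code for $\mathbf{W}$ is a family $\mathcal{C}_{\mathrm{id}}=(P_m,Q_n,I_{mn})_{m=1,n=1}^{M,N}$ with $P_1,\dots,P_M\in\mathcal{P}(\mathcal{X}^k)$, $Q_1,\dots,Q_N\in\mathcal{P}(\mathcal{Y}^k)$, $I_{mn}\in\mathcal{L}(\mathcal{H}^{\otimes k})$, $0\le I_{mn}\le\mathbb{1}$. Its two errors are $$e_1(\mathcal{C}_{\mathrm{id}},W^k)=\max_{m\in[M],n\in[N]}\Big(1-\sum_{x^k,y^k}P_m(x^k)Q_n(y^k)\mathrm{tr}(I_{mn}W^k(x^k,y^k))\Big),$$ $$e_2(\mathcal{C}_{\mathrm{id}},W^k)=\max_{(m,n)\ne(m',n')}\sum_{x^k,y^k}P_m(x^k)Q_n(y^k)\mathrm{tr}(I_{m'n'}W^k(x^k,y^k)),$$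 with $m,m'\in[M]$, $n,n'\in[N]$, and sums over $x^k\in\mathcal{X}^k$, $y^k\in\mathcal{Y}^k$. The ID-code is simultaneous if there exist $R,S\in\mathbb{N}$, a POVM $(E_{rs})_{r=1,s=1}^{R,S}$ and subsets $A_1,\dots,A_M\subset[R]$, $B_1,\dots,B_N\subset[S]$ such that $I_{mn}=\sum_{i\in A_m}\sum_{j\in B_n}E_{ij}$ for all $m,n$. A pair $(R_1,R_2)\in\mathbb{R}^2$ with $R_1,R_2\ge0$ is an achievable simultaneous ID-rate pair if for all $\epsilon_1,\epsilon_2,\delta>0$ there is $k_0$ such that for all $k\ge k_0$ there is a simultaneous $(k,M,N)$-ID-code with $\frac1k\log\log M\ge R_1-\delta$, $\frac1k\log\log N\ge R_2-\delta$, $e_1\le\epsilon_1$, $e_2\le\epsilon_2$. $C_{\mathrm{id}}^{\mathrm{sim}}(\mathbf{W})$ is the set of all achievable simultaneous ID-rate pairs.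
   Formalization: The value log log 1 is taken to be 0, so a single message for a sender counts as ID rate 0; with log 0 = −∞ the claim fails, e.g. for constant W, where (0,0) is in C(W) but the simultaneous ID region would be empty. *)

(* Defs.v *)
From HB Require Import structures.
From mathcomp Require Import all_boot all_order all_algebra.
From mathcomp Require Import complex mxtens.
From mathcomp Require Import boolp classical_sets reals exp.

Set Implicit Arguments.
Unset Strict Implicit.
Unset Printing Implicit Defensive.

Import Order.TTheory GRing.Theory Num.Theory.

Local Open Scope ring_scope.
Local Open Scope complex_scope.
Local Open Scope sesquilinear_scope.

Section Operators.
Variable R : realType.

(* In the order of [R[i]], [0 <= z] says that [z] is real and nonnegative. *)
Definition psd n (A : 'M[R[i]]_n) : Prop :=
  A \is hermsymmx /\ forall v : 'cV[R[i]]_n, 0 <= (v^t* *m A *m v) 0 0.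

Definition op_le n (A B : 'M[R[i]]_n) : Prop := psd (B - A).

Definition povm (I : finType) n (E : I -> 'M[R[i]]_n) : Prop :=
  (forall i, psd (E i)) /\ \sum_i E i = 1%:M.

(* The states on the Hilbert space [C^n]. *)
Record state n := State {
  density_op :> 'M[R[i]]_n;
  state_psd : psd density_op;
  state_tr : \tr density_op = 1 }.

(* The dimension of the [k]-th tensor power of [C^d]. It equals [d ^ k], but
   unlike [d ^ k.+1] it unfolds to the dimension [d * _] of [_ *t _]. *)
Definition tdim (d k : nat) : nat := iter k (muln d) 1%N.

(* [A 0 *t (A 1 *t (... *t (A k.-1 *t 1)))] *)
Fixpoint tens d k : ('I_k -> 'M[R[i]]_d) -> 'M[R[i]]_(tdim d k) :=
  match k return ('I_k -> 'M[R[i]]_d) -> 'M[R[i]]_(tdim d k) with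
  | 0 => fun _ => 1%:M
  | k'.+1 => fun A => A ord0 *t tens (fun i : 'I_k' => A (lift ord0 i))
  end.

Lemma psd_gram m n (B : 'M[R[i]]_(m, n)) : psd (B^t* *m B).
Proof.
split.
  apply/is_hermitianmxP; rewrite expr0 scale1r.
  by rewrite trmx_mul map_mxM trmxCK.
move=> v; rewrite mulmxA -mulmxA -map_mxM -trmx_mul mxE.
by apply: sumr_ge0 => i _; rewrite !mxE mulrC mul_conjC_ge0.
Qed.

Lemma psd_gramP n (A : 'M[R[i]]_n) :
  psd A -> exists B : 'M[R[i]]_n, A = B^t* *m B.
Proof.
case=> hA pA; have /orthomx_spectralP AE := hermitian_normalmx hA.
move: (spectralmx A) (spectral_diag A) (spectral_unitarymx A) AE => P s uP AE.
rewrite invmx_unitary // in AE.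
have s0 i : 0 <= s 0 i.
  have := pA (P^t* *m delta_mx i 0).
  rewrite AE trmx_mul map_mxM trmxCK !mulmxA.
  rewrite mulmxtVK // -!mulmxA.
  rewrite [P *m (_ *m _)]mulmxA (unitarymxP uP) mul1mx.
  rewrite trmx_delta map_delta_mx mulmxA -rowE row_diag_mx -scalemxAl mxE.
  by rewrite mul_delta_mx mxE !eqxx mulr1.
exists (diag_mx (map_mx sqrtC s) *m P).
rewrite {1}AE trmx_mul map_mxM mulmxA tr_diag_mx map_diag_mx.
rewrite -[_ *m diag_mx _ *m diag_mx _]mulmxA mulmx_diag.
congr (_ *m diag_mx _ *m _); apply/rowP => i; rewrite !mxE.
by rewrite -normCKC ger0_norm ?sqrtC_ge0 // sqrtCK.
Qed.

Lemma psd_tensmx m n (A : 'M[R[i]]_m) (B : 'M[R[i]]_n) :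
  psd A -> psd B -> psd (A *t B).
Proof.
move=> /psd_gramP[S ->] /psd_gramP[T ->].
rewrite -tensmx_mul -map_mxT -trmx_tens; exact: psd_gram.
Qed.

Lemma mxtrace_tensmx m n (A : 'M[R[i]]_m) (B : 'M[R[i]]_n) :
  \tr (A *t B) = \tr A * \tr B.
Proof.
rewrite /mxtrace mulr_sum; apply: eq_bigr => i _.
by rewrite mxE.
Qed.

Lemma psd1 n : psd (1%:M : 'M[R[i]]_n).
Proof. by have := psd_gram (1%:M : 'M[R[i]]_n); rewrite trmx1 map_mx1 mulmx1. Qed.

Lemma psd_tens d k (A : 'I_k -> 'M[R[i]]_d) :
  (forall i, psd (A i)) -> psd (tens A).
Proof.
elim: k A => [|k IHk] A pA /=; first exact: psd1.
by apply: psd_tensmx => //; apply: IHk.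
Qed.

Lemma mxtrace_tens d k (A : 'I_k -> 'M[R[i]]_d) :
  \tr (tens A) = \prod_(i < k) \tr (A i).
Proof.
elim: k A => [|k IHk] A /=; first by rewrite mxtrace1 big_ord0.
by rewrite mxtrace_tensmx big_ord_recl IHk.
Qed.

Lemma mxtrace_tens_state d k (A : 'I_k -> state d) :
  \tr (tens (fun i => A i : 'M[R[i]]_d)) = 1.
Proof. by rewrite mxtrace_tens big1 // => i _; apply: state_tr. Qed.

Definition tens_state d k (A : 'I_k -> state d) : state (tdim d k) :=
  State (psd_tens (fun i => state_psd (A i))) (mxtrace_tens_state A).

(* [tr (D rho)], which is real when [D] is Hermitian. *)
Definition prob n (D : 'M[R[i]]_n) (rho : state n) : R :=
  complex.Re (\tr (D *m rho)).

End Operators.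

Definition is_distr (R : realType) (T : finType) (p : T -> R) : Prop :=
  (forall t, 0 <= p t) /\ \sum_t p t = 1.

(* [ln 0 = 0], hence [log2 0 = 0]. For [M : nat] with [0 < M], this is used
   only in [log2 (log2 M%:R)] at [M = 1], which is [0] instead of [-oo]: an
   ID-code with a single message for a sender counts as one of rate [0] for that
   sender. With the value [-oo], the simultaneous ID capacity region would be
   empty as soon as one of the senders cannot influence the output, although
   [(0, 0)] is an achievable transmission rate pair. *)
Definition log2 (R : realType) (x : R) : R := ln x / ln 2.

Section Channels.
Variables (R : realType) (X Y : finType) (d : nat).

Definition ccq_channel : Type :=
  forall k : nat, k.-tuple X -> k.-tuple Y -> state R (tdim d k).

Definition dm_ccq (W : X -> Y -> state R d) : ccq_channel :=
  fun k x y => tens_state (fun i : 'I_k => W (tnth x i) (tnth y i)).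

Record code (k M N : nat) := Code {
  enc1 : 'I_M -> k.-tuple X;
  enc2 : 'I_N -> k.-tuple Y;
  dec : 'I_M -> 'I_N -> 'M[R[i]]_(tdim d k);
  dec_povm : povm (fun mn : 'I_M * 'I_N => dec mn.1 mn.2) }.

Definition avg_error k M N (c : code k M N)
    (Wk : k.-tuple X -> k.-tuple Y -> state R (tdim d k)) : R :=
  1 - (M%:R * N%:R)^-1 *
    \sum_(m < M) \sum_(n < N) prob (dec c m n) (Wk (enc1 c m) (enc2 c n)).

Definition achievable (W : ccq_channel) (r : R * R) : Prop :=
  forall eps delta : R, 0 < eps -> 0 < delta ->
  exists k0 : nat, forall k : nat, (k0 <= k)%N ->
  exists M N : nat, [/\ (0 < M)%N, (0 < N)%N &
  exists c : code k M N,
    [/\ k%:R^-1 * log2 M%:R >= r.1 - delta,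
        k%:R^-1 * log2 N%:R >= r.2 - delta &
        avg_error c (W k) <= eps]].

Definition capacity_region (W : ccq_channel) : set (R * R) :=
  [set r | [/\ 0 <= r.1, 0 <= r.2 & achievable W r]]%classic.

Record id_code (k M N : nat) := IdCode {
  id_enc1 : 'I_M -> k.-tuple X -> R;
  id_enc2 : 'I_N -> k.-tuple Y -> R;
  id_test : 'I_M -> 'I_N -> 'M[R[i]]_(tdim d k);
  id_enc1_distr : forall m, is_distr (id_enc1 m);
  id_enc2_distr : forall n, is_distr (id_enc2 n);
  id_test_ge0 : forall m n, op_le 0 (id_test m n);
  id_test_le1 : forall m n, op_le (id_test m n) 1%:M }.

(* The probability that the test for [mn'] accepts when [mn] is sent. *)
Definition id_accept k M N (c : id_code k M N)
    (Wk : k.-tuple X -> k.-tuple Y -> state R (tdim d k))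
    (mn mn' : 'I_M * 'I_N) : R :=
  \sum_(x : k.-tuple X) \sum_(y : k.-tuple Y)
    id_enc1 c mn.1 x * id_enc2 c mn.2 y *
    prob (id_test c mn'.1 mn'.2) (Wk x y).

(* The quantities maximized in both errors are nonnegative, so that the default
   value [0] only matters for maxima over an empty set. *)
Definition id_error1 k M N (c : id_code k M N)
    (Wk : k.-tuple X -> k.-tuple Y -> state R (tdim d k)) : R :=
  \big[Num.max/0]_(mn : 'I_M * 'I_N) (1 - id_accept c Wk mn mn).

Definition id_error2 k M N (c : id_code k M N)
    (Wk : k.-tuple X -> k.-tuple Y -> state R (tdim d k)) : R :=
  \big[Num.max/0]_(p : ('I_M * 'I_N) * ('I_M * 'I_N) | p.1 != p.2)
    id_accept c Wk p.1 p.2.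

Definition simultaneous k M N (c : id_code k M N) : Prop :=
  exists (K L : nat) (E : 'I_K -> 'I_L -> 'M[R[i]]_(tdim d k))
         (A : 'I_M -> {set 'I_K}) (B : 'I_N -> {set 'I_L}),
    povm (fun rs : 'I_K * 'I_L => E rs.1 rs.2) /\
    forall m n, id_test c m n = \sum_(r in A m) \sum_(s in B n) E r s.

Definition sim_id_achievable (W : ccq_channel) (r : R * R) : Prop :=
  forall eps1 eps2 delta : R, 0 < eps1 -> 0 < eps2 -> 0 < delta ->
  exists k0 : nat, forall k : nat, (k0 <= k)%N ->
  exists M N : nat, [/\ (0 < M)%N, (0 < N)%N &
  exists c : id_code k M N, simultaneous c /\
    [/\ k%:R^-1 * log2 (log2 M%:R) >= r.1 - delta,
        k%:R^-1 * log2 (log2 N%:R) >= r.2 - delta,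
        id_error1 c (W k) <= eps1 &
        id_error2 c (W k) <= eps2]].

Definition sim_id_capacity_region (W : ccq_channel) : set (R * R) :=
  [set r | [/\ 0 <= r.1, 0 <= r.2 & sim_id_achievable W r]]%classic.

End Channels.

(* Main.v *)
(** Both inclusions hold at each block length, for any CCQ channel.

    From a transmission code, each sender of the identification code transmits a
    uniformly random index from a subset of its codewords. The subsets contain a
    fixed fraction of the codewords, so that the average error over a product of
    two subsets is at most a constant times the average error of the code, and
    by Gilbert's bound exponentially many of them intersect pairwise in a small
    proportion.

    Conversely, fix the simultaneous measurement and one message [n] of the
    second sender. If the channel from the first input to the first outcome has
    density [V(r|x) / PV(r)] at most [theta] with probability more than [c] under
    the input distribution of a message [m], then the corresponding part of the
    output distribution is covered by about [theta] well-chosen inputs. Since the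
    acceptance sets are almost disjoint, one tuple of inputs serves boundedly
    many messages, and there are far fewer tuples than messages. Hence for most
    pairs [(m, n)] both densities are large with high probability, and random
    codes drawn from the two input distributions of such a pair transmit
    reliably, each sender treating the other as noise. *)
Require Import Defs.
From mathcomp Require Import all_boot all_order all_algebra.
From mathcomp Require Import complex ring lra.
From mathcomp Require Import boolp classical_sets reals sequences exp.

Set Implicit Arguments.
Unset Strict Implicit.
Unset Printing Implicit Defensive.

Import Order.TTheory GRing.Theory Num.Theory.

Local Open Scope ring_scope.

(** * Measurement statistics *)

Section Operators.
Local Open Scope complex_scope.
Local Open Scope sesquilinear_scope.
Variable R : realType.
Local Notation Mx n := 'M[R[i]]_n.

Lemma psd0 n : psd (0 : Mx n).
Proof. by have := psd_gram (0 : Mx n); rewrite mulmx0. Qed.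

Lemma psdD n (A B : Mx n) : psd A -> psd B -> psd (A + B).
Proof.
case=> /is_hermitianmxP hA pA [/is_hermitianmxP hB pB]; split.
  apply/is_hermitianmxP; rewrite expr0 scale1r !linearD /=.
  by rewrite map_mxD {1}hA {1}hB !expr0 !scale1r.
by move=> v; rewrite mulmxDr mulmxDl mxE addr_ge0.
Qed.

Lemma psd_sum n (I : finType) (P : pred I) (F : I -> Mx n) :
  (forall i, psd (F i)) -> psd (\sum_(i | P i) F i).
Proof.
move=> pF; elim/big_ind: _ => //; [exact: psd0 | exact: psdD].
Qed.

(** With [D] and [rho] written as Gram matrices of [B] and [C], cyclicity turns the trace into that
    of the Gram matrix of [G], the product of [C] and the adjoint of [B]. *)
Lemma prob_ge0 n (D : Mx n) (rho : state R n) : psd D -> 0 <= prob D rho.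
Proof.
move=> /psd_gramP[B ->]; have [C CE] := psd_gramP (state_psd rho).
rewrite /prob CE -mulmxA mxtrace_mulC mulmxA.
set G := C *m B^t*.
have GE : B *m C^t* = G^t* by rewrite /G trmx_mul map_mxM trmxCK.
rewrite GE -mulmxA -/G.
suff: 0 <= \tr (G^t* *m G) by rewrite lecE /= => /andP[].
apply: sumr_ge0 => i _; rewrite !mxE; apply: sumr_ge0 => j _.
by rewrite !mxE mulrC mul_conjC_ge0.
Qed.

Lemma prob_sum n (I : finType) (P : pred I) (F : I -> Mx n) (rho : state R n) :
  prob (\sum_(i | P i) F i) rho = \sum_(i | P i) prob (F i) rho.
Proof.
by rewrite /prob mulmx_suml (raddf_sum (@mxtrace R[i] n)) (raddf_sum (@complex.Re R)).
Qed.

Lemma prob1 n (rho : state R n) : prob 1%:M rho = 1.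
Proof. by rewrite /prob mul1mx state_tr. Qed.

Lemma povm_distr (I J : finType) n (E : I -> J -> Mx n) (rho : state R n) :
  povm (fun ij : I * J => E ij.1 ij.2) ->
  is_distr (fun ij : I * J => prob (E ij.1 ij.2) rho).
Proof.
case=> pE sE; split=> [ij|]; first exact/prob_ge0/pE.
by rewrite -prob_sum sE prob1.
Qed.

End Operators.

(** * Means over finite and product distributions *)

Section Distributions.
Variable R : realType.

(** The passage from an average to a single choice. If [f] exceeded [a] everywhere, the nonnegative
    terms [P t * (f t - a)] would all vanish, which forces [P = 0]. *)
Lemma exists_le_mean (T : finType) (P f : T -> R) (a : R) :
  is_distr P -> \sum_t P t * f t <= a -> exists t, f t <= a.
Proof.
case=> P0 P1 le_a; apply/existsP; apply: contraT; rewrite negb_exists.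
move=> /forallP gt_a.
have ge0 t : 0 <= P t * (f t - a).
  by rewrite mulr_ge0 // subr_ge0 ltW // ltNge.
have : \sum_t P t * (f t - a) <= 0.
  under eq_bigr do rewrite mulrBr.
  by rewrite sumrB -mulr_suml P1 mul1r subr_le0.
rewrite le_eqVlt ltNge sumr_ge0 // orbF psumr_eq0 // => /allP z.
suff: \sum_t P t = 0 by rewrite P1 => /eqP; rewrite oner_eq0.
apply: big1 => t _; have := z t (mem_index_enum t); rewrite mulf_eq0.
by case/orP=> /eqP // /eqP; rewrite subr_eq0 => /eqP ft; have := gt_a t; rewrite ft lexx.
Qed.

Lemma prod_mean (I T : finType) (P : T -> R) (h : I -> T -> R) :
  \sum_(f : {ffun I -> T}) (\prod_i P (f i)) * \prod_i h i (f i) =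
  \prod_i \sum_t P t * h i t.
Proof.
rewrite bigA_distr_bigA /=; apply: eq_bigr => f _.
by rewrite -big_split.
Qed.

Lemma prod_distr (I T : finType) (P : T -> R) :
  is_distr P -> is_distr (fun f : {ffun I -> T} => \prod_i P (f i)).
Proof.
case=> P0 P1; split=> [f|]; first exact: prodr_ge0.
transitivity (\prod_(i : I) \sum_t P t * 1).
  by rewrite -prod_mean; apply: eq_bigr => f _; rewrite [X in _ * X]big1 ?mulr1.
by apply: big1 => i _; under eq_bigr do rewrite mulr1.
Qed.

(** Expanding [h] over the values [a], [b] of the two coordinates leaves means of indicators, which
    [prod_mean] factors by independence. *)
Lemma prod_mean2 (I T : finType) (P : T -> R) (i j : I) (h : T -> T -> R) :
  is_distr P -> i != j ->
  \sum_(f : {ffun I -> T}) (\prod_l P (f l)) * h (f i) (f j) =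
  \sum_a \sum_b P a * P b * h a b.
Proof.
case=> P0 P1 ij; have ji : j != i by rewrite eq_sym.
transitivity (\sum_a \sum_b h a b *
  \sum_(f : {ffun I -> T}) (\prod_l P (f l)) * ((f i == a)%:R * (f j == b)%:R)).
  transitivity (\sum_(f : {ffun I -> T}) \sum_a \sum_b
    h a b * ((\prod_l P (f l)) * ((f i == a)%:R * (f j == b)%:R))).
    apply: eq_bigr => f _; rewrite (bigD1 (f i)) //= (bigD1 (f j)) //= !eqxx !mulr1.
    rewrite [\sum_(_ | _ != f j) _]big1 => [|b /negPf nb]; last first.
      by rewrite eq_sym nb /= !(mulr0n, mulr0).
    rewrite [\sum_(_ | _ != f i) _]big1 => [|a /negPf na]; first by rewrite !addr0 mulrC.
    by apply: big1 => b _; rewrite eq_sym na /= !(mulr0n, mul0r, mulr0).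
  rewrite exchange_big; apply: eq_bigr => a _.
  rewrite exchange_big; apply: eq_bigr => b _.
  by rewrite mulr_sumr.
apply: eq_bigr => a _; apply: eq_bigr => b _; rewrite mulrC; congr (_ * _).
(* The joint indicator of [f i = a] and [f j = b], written as a product over all coordinates. *)
pose g l t : R := if l == i then (t == a)%:R else if l == j then (t == b)%:R else 1.
have gE f : \prod_l g l (f l) = ((f i == a)%:R * (f j == b)%:R).
  rewrite (bigD1 i) //= (bigD1 j ji) /= big1 => [|l /andP[/negPf li /negPf lj]].
    by rewrite /g !eqxx (negPf ji) mulr1.
  by rewrite /g li lj.
under eq_bigr do rewrite -gE.
rewrite prod_mean (bigD1 i) //= (bigD1 j ji) /= [X in _ * (_ * X)]big1
  => [|l /andP[/negPf li /negPf lj]].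
  rewrite /g !eqxx (negPf ji) mulr1; congr (_ * _).
    by rewrite (bigD1 a) //= big1 ?eqxx ?mulr1 ?addr0 // => t /negPf ->; rewrite mulr0.
  by rewrite (bigD1 b) //= big1 ?eqxx ?mulr1 ?addr0 // => t /negPf ->; rewrite mulr0.
by rewrite /g li lj; under eq_bigr do rewrite mulr1.
Qed.

Lemma prod_mean1 (I T : finType) (P : T -> R) (i : I) (h : T -> R) :
  is_distr P ->
  \sum_(f : {ffun I -> T}) (\prod_l P (f l)) * h (f i) = \sum_a P a * h a.
Proof.
case=> P0 P1.
transitivity (\sum_a h a *
  \sum_(f : {ffun I -> T}) (\prod_l P (f l)) * (f i == a)%:R).
  transitivity (\sum_(f : {ffun I -> T}) \sum_a
    h a * ((\prod_l P (f l)) * (f i == a)%:R)).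
    apply: eq_bigr => f _; rewrite (bigD1 (f i)) //= eqxx mulr1.
    by rewrite [X in _ + X]big1 ?addr0 ?mulr1 1?mulrC // => b /negPf nb;
      rewrite eq_sym nb /= !(mulr0n, mulr0).
  by rewrite exchange_big; apply: eq_bigr => a _; rewrite mulr_sumr.
apply: eq_bigr => a _; rewrite mulrC; congr (_ * _).
pose g l t : R := if l == i then (t == a)%:R else 1.
have gE f : \prod_l g l (f l) = (f i == a)%:R.
  rewrite (bigD1 i) //= big1 => [|l /negPf li]; by rewrite /g ?li // eqxx mulr1.
under eq_bigr do rewrite -gE.
rewrite prod_mean (bigD1 i) //= [X in _ * X]big1 => [|l /negPf li].
  rewrite /g !eqxx mulr1.
  by rewrite (bigD1 a) //= big1 ?eqxx ?mulr1 ?addr0 // => t /negPf ->; rewrite mulr0.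
by rewrite /g li; under eq_bigr do rewrite mulr1.
Qed.

End Distributions.

(** * Soft covering *)

Section Resolvability.
Variables (R : realType) (X Z : finType).

Definition is_channel (V : X -> Z -> R) := forall x, is_distr (V x).

Definition output (P : X -> R) (V : X -> Z -> R) z := \sum_x P x * V x z.

(* The part of [V] on the pairs of information density at most [log theta]. *)
Definition low (theta : R) (P : X -> R) (V : X -> Z -> R) x z :=
  if V x z <= theta * output P V z then V x z else 0.

(** The distribution function of the information density, evaluated at [log theta]. Random coding
    works when it is small, covering by few inputs when it is not. *)
Definition low_mass theta P V := \sum_x P x * \sum_z low theta P V x z.

Lemma output_distr P V : is_distr P -> is_channel V -> is_distr (output P V).
Proof.
move=> [P0 P1] hV; split=> [z|].
  by apply: sumr_ge0 => x _; rewrite mulr_ge0 //; case: (hV x).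
rewrite exchange_big -P1; apply: eq_bigr => x _.
by rewrite -mulr_sumr; case: (hV x) => _ ->; rewrite mulr1.
Qed.

Lemma low_ge0 theta P V x z : is_channel V -> 0 <= low theta P V x z.
Proof. by move=> hV; rewrite /low; case: ifP => // _; case: (hV x). Qed.

Lemma low_le theta P V x z : is_channel V -> low theta P V x z <= V x z.
Proof. by move=> hV; rewrite /low; case: ifP => // _; case: (hV x). Qed.

Lemma low_le_output theta P V x z : 0 <= theta -> is_distr P ->
  is_channel V -> low theta P V x z <= theta * output P V z.
Proof.
move=> t0 dP hV; rewrite /low; case: ifP => // _.
by rewrite mulr_ge0 //; case: (output_distr dP hV).
Qed.

(** Obtained by summing [low <= theta * output] over the outputs. It settles the case of thresholds
    below the tolerated mass. *)
Lemma low_mass_le theta P V : 0 <= theta -> is_distr P -> is_channel V ->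
  low_mass theta P V <= theta.
Proof.
move=> t0 dP hV; have [P0 P1] := dP.
rewrite -[leRHS]mul1r -P1 mulr_suml; apply: ler_sum => x _.
apply: ler_wpM2l => //; rewrite -[leRHS]mulr1.
have [_ <-] := output_distr dP hV; rewrite mulr_sumr.
by apply: ler_sum => z _; apply: low_le_output.
Qed.

(* Expanding the square around the mean, each new sample raises the expected
   weighted deviation by at most the weighted second moment, so some choice of
   the sample does not raise it by more. *)
Lemma greedy_sample (P : X -> R) (g : X -> Z -> R) (w : Z -> R) (B : R) K :
  is_distr P -> (forall z, 0 <= w z) ->
  \sum_x P x * \sum_z w z * g x z ^+ 2 <= B ->
  exists t : K.-tuple X,
    \sum_z w z * (\sum_(x <- t) g x z - K%:R * output P g z) ^+ 2 <= K%:R * B.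
Proof.
move=> dP w0 gB; have [P0 P1] := dP.
elim: K => [|K [t tP]].
  exists [tuple]; rewrite mul0r le_eqVlt; apply/orP; left; apply/eqP.
  by apply: big1 => z _; rewrite big_nil mul0r subr0 expr0n /= mulr0.
pose D z := \sum_(x <- t) g x z - K%:R * output P g z.
pose h x := \sum_z w z * (D z + (g x z - output P g z)) ^+ 2.
have [||x hx] := @exists_le_mean R X P h (K.+1%:R * B) => //; last first.
  exists [tuple of x :: t]; apply: le_trans hx; rewrite le_eqVlt; apply/orP; left.
  apply/eqP; apply: eq_bigr => z _; rewrite big_cons /D; congr (_ * _ ^+ 2).
  by rewrite -natr1; ring.
apply: (@le_trans _ _ (\sum_z w z * D z ^+ 2 +
    \sum_x P x * \sum_z w z * g x z ^+ 2)); last first.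
  by rewrite -natr1 mulrDl mul1r lerD.
have -> : \sum_x P x * \sum_z w z * g x z ^+ 2 =
    \sum_z w z * \sum_x P x * g x z ^+ 2.
  under eq_bigr do rewrite mulr_sumr.
  rewrite exchange_big; apply: eq_bigr => z _; rewrite mulr_sumr.
  by apply: eq_bigr => x _; rewrite mulrCA.
have -> : \sum_x P x * h x =
    \sum_z w z * \sum_x P x * (D z + (g x z - output P g z)) ^+ 2.
  under eq_bigr do rewrite mulr_sumr.
  rewrite exchange_big; apply: eq_bigr => z _; rewrite mulr_sumr.
  by apply: eq_bigr => x _; rewrite mulrCA.
rewrite -big_split; apply: ler_sum => z _ /=; rewrite -mulrDr ler_wpM2l //.
(* The factor [\sum_x P x] makes the identity linear in [P], so it is checked for each [x]. Once
   this factor is 1, the first two terms add up to [D z ^+ 2 - output P g z ^+ 2]. *)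
have -> : \sum_x P x * (D z + (g x z - output P g z)) ^+ 2 =
    (\sum_x P x) * (D z - output P g z) ^+ 2 +
    2 * (D z - output P g z) * output P g z + \sum_x P x * g x z ^+ 2.
  rewrite {4}/output mulr_suml mulr_sumr -!big_split /=.
  by apply: eq_bigr => x _; ring.
rewrite P1 lerD2r -subr_ge0.
by rewrite [leRHS](_ : _ = output P g z ^+ 2) ?sqr_ge0 //; ring.
Qed.

(** Greedy sampling is applied with weights inverse to the output. The weighted second moment is at
    most [theta], since one factor [low] is bounded by [theta * output] and the other by [V]. *)
Lemma soft_covering (P : X -> R) (V : X -> Z -> R) (theta alpha : R) K :
  is_distr P -> is_channel V -> 0 < theta -> 0 < alpha -> (0 < K)%N ->
  theta <= K%:R * alpha ^+ 2 ->
  exists t : K.-tuple X,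
    \sum_z `|K%:R^-1 * \sum_(x <- t) low theta P V x z
             - output P (low theta P V) z| <= alpha.
Proof.
move=> dP hV t0 a0 K0 tK; have [P0 P1] := dP.
have [O0 O1] := output_distr dP hV.
have KR : 0 < K%:R :> R by rewrite ltr0n.
have [||t tP] := @greedy_sample P (low theta P V) (fun z => (output P V z)^-1)
    theta K dP.
- by move=> z; rewrite invr_ge0.
- rewrite -[leRHS]mul1r -P1 mulr_suml; apply: ler_sum => x _.
  apply: ler_wpM2l => //; rewrite -[leRHS]mulr1.
  have [V0 <-] := hV x; rewrite mulr_sumr; apply: ler_sum => z _.
  have lt := low_le_output x z (ltW t0) dP hV.
  have l0 := @low_ge0 theta P V x z hV.
  have lV := @low_le theta P V x z hV.
  (* Since [0^-1 = 0], the weight vanishes where the output does. *)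
  have [Oz|Oz] := eqVneq (output P V z) 0.
    by rewrite Oz invr0 mul0r mulr_ge0 // ltW.
  have Ogt : 0 < output P V z by rewrite lt_def Oz O0.
  rewrite mulrC ler_pdivrMr // mulrAC expr2.
  by apply: ler_pM.
exists t; set d := fun z => \sum_(x <- t) low theta P V x z -
    K%:R * output P (low theta P V) z in tP.
(* Young's inequality passes from weighted squares to absolute values, with constants that make each
   of the two sums at most [alpha / 2]. *)
apply: (@le_trans _ _ (\sum_z ((2 * alpha * K%:R ^+ 2)^-1 *
    ((output P V z)^-1 * d z ^+ 2) + alpha / 2 * output P V z))).
  apply: ler_sum => z _.
  have -> : K%:R^-1 * \sum_(x <- t) low theta P V x z -
      output P (low theta P V) z = K%:R^-1 * d z.
    by rewrite /d mulrBr mulKf ?gt_eqF.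
  rewrite normrM gtr0_norm ?invr_gt0 //.
  (* A zero weight gives no control of the deviation, but there [low <= theta * output] makes the
     deviation itself zero. *)
  have [Oz|Oz] := eqVneq (output P V z) 0.
    have l0 x : low theta P V x z = 0.
      apply/eqP; rewrite eq_le low_ge0 // andbT.
      by rewrite -(mulr0 theta) -Oz low_le_output // ltW.
    have -> : d z = 0.
      rewrite /d /output !big1 ?mulr0 ?subr0 //.
        by move=> x _; rewrite l0 mulr0.
    by rewrite normr0 expr0n /= !mulr0 Oz mulr0 addr0.
  have Ogt : 0 < output P V z by rewrite lt_def Oz O0.
  rewrite -[in leRHS](real_normK (num_real (d z))).
  set a := `|d z|; set o := output P V z in Ogt *.
  have -> : (2 * alpha * K%:R ^+ 2)^-1 * (o^-1 * a ^+ 2) + alpha / 2 * o =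
     K%:R^-1 * a + (2 * alpha * o)^-1 * (a / K%:R - alpha * o) ^+ 2.
    by field; rewrite !gt_eqF.
  by rewrite lerDl mulr_ge0 ?sqr_ge0 // invr_ge0 !mulr_ge0 // ltW.
rewrite big_split /= -!mulr_sumr O1 mulr1.
apply: (@le_trans _ _ ((2 * alpha * K%:R ^+ 2)^-1 * (K%:R * theta) + alpha / 2)).
  by rewrite lerD2r ler_wpM2l // invr_ge0 !mulr_ge0 // ltW.
apply: (@le_trans _ _ ((2 * alpha * K%:R ^+ 2)^-1 *
    (K%:R * (K%:R * alpha ^+ 2)) + alpha / 2)).
  rewrite lerD2r ler_wpM2l ?invr_ge0 ?mulr_ge0 ?(ltW a0) ?(ltW KR) //.
  by rewrite ler_wpM2l // ltW.
rewrite le_eqVlt; apply/orP; left; apply/eqP; field.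
by rewrite !gt_eqF.
Qed.

End Resolvability.

(** * Counting the messages of low information density *)

Section FewBad.
Variables (R : realType) (X Z : finType).

(** A point of [A i] that lies in another [A j] is cancelled by the subtracted sum. Only points
    lying in exactly one of the sets remain, and each contributes at most [mu z], once. *)
Lemma sum_uniquely_covered_le (I : finType) (S : {set I}) (A : I -> {set Z})
    (g : I -> Z -> R) (mu : Z -> R) :
  (forall z, 0 <= mu z) -> (forall i z, 0 <= g i z <= mu z) ->
  \sum_(i in S) (\sum_(z in A i) g i z -
     \sum_(j in S | j != i) \sum_(z in A j) g i z) <= \sum_z mu z.
Proof.
move=> mu0 gmu.
pose u i z := (z \in A i) && [forall (j | (j \in S) && (j != i)), z \notin A j].
apply: (@le_trans _ _ (\sum_(i in S) \sum_z (u i z)%:R * mu z)).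
  apply: ler_sum => i iS.
  rewrite lerBlDr big_mkcond /=; under [X in _ <= _ + X]eq_bigr do rewrite big_mkcond /=.
  rewrite exchange_big -big_split /=; apply: ler_sum => z _.
  have /andP[g0 gm] := gmu i z.
  have s0 (P : pred I) : 0 <= \sum_(j | P j) (if z \in A j then g i z else 0).
    by apply: sumr_ge0 => j _; case: ifP.
  rewrite /u; case: ifP => zA /=; last by rewrite mul0r add0r s0.
  case: forallP => [uz|nuz]; first by rewrite mul1r -[leLHS]addr0 lerD ?s0.
  rewrite mul0r add0r.
  have /existsP[j] : [exists j, ~~ (((j \in S) && (j != i)) ==> (z \notin A j))].
    rewrite -negb_forall; apply/negP => /forallP //.
  rewrite negb_imply negbK => /andP[jS zj].
  by rewrite (bigD1 j) //= zj lerDl s0.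
rewrite exchange_big; apply: ler_sum => z _ /=.
rewrite -mulr_suml -[leRHS]mul1r ler_wpM2r //.
have [i /andP[iS ui]|nu] := pickP (fun i => (i \in S) && u i z); last first.
  by rewrite big1 // => i iS; have := nu i; rewrite iS /= => ->.
rewrite (bigD1 i) //= big1 => [|j /andP[jS ji]]; first by rewrite addr0 lern1 leq_b1.
case/andP: ui => zi _; rewrite /u.
have -> : [forall (l | (l \in S) && (l != j)), z \notin A l] = false.
  by apply/negP => /forallP/(_ i); rewrite iS eq_sym ji zi.
by rewrite andbF.
Qed.

(* A tuple of inputs whose output distribution covers a fixed proportion of the
   output under [P m] covers a fixed part of the almost disjoint set [A m];
   hence it can serve fewer than [T] messages [m]. *)
Lemma card_low_mass_le (M : nat) (P : 'I_M -> X -> R) (A : 'I_M -> {set Z})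
    (V : X -> Z -> R) (theta alpha eta c : R) (K T : nat) :
  (forall m, is_distr (P m)) -> is_channel V ->
  0 < theta -> 0 < alpha -> 0 <= eta -> (0 < K)%N ->
  theta <= K%:R * alpha ^+ 2 ->
  (forall m, 1 - eta <= \sum_(z in A m) output (P m) V z) ->
  (forall m m', m != m' -> \sum_(z in A m') output (P m) V z <= 2 * eta) ->
  1 < T%:R * (c - T%:R * (2 * eta + alpha)) ->
  (#|[set m | (c < low_mass theta (P m) V)%R]| <= #|X| ^ K * T)%N.
Proof.
move=> dP hV t0 a0 e0 K0 tK A1 A2 T1.
(* Each message is assigned a covering tuple. It remains to show that no tuple is assigned to more
   than [T] messages of large low mass. *)
have [tau tauP] := choice (fun m => soft_covering (dP m) hV t0 a0 K0 tK).
set B := [set m | _].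
have -> : #|B| = (\sum_(t : K.-tuple X) #|[set m in B | tau m == t]|)%N.
  rewrite -sum1_card (partition_big tau xpredT) //=; apply: eq_bigr => t _.
  by rewrite -sum1_card; apply: eq_bigl => m; rewrite inE.
rewrite -card_tuple -sum_nat_const; apply: leq_sum => t _.
set F := [set m in B | _]; rewrite leqNgt; apply/negP => TF.
(* The hypothesis on [T] is not monotone in [T], so exactly [T] messages of the fibre are kept. *)
pose S := [set m in take T (enum F)].
have cS : #|S| = T.
  rewrite cardsE (card_uniqP _) ?take_uniq ?enum_uniq //.
  by rewrite size_take -cardE TF.
have SF m : m \in S -> m \in F.
  by rewrite inE => /mem_take; rewrite mem_enum.
pose g m z := K%:R^-1 * \sum_(x <- t) low theta (P m) V x z.
pose mu z := K%:R^-1 * \sum_(x <- t) V x z.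
have KR : 0 < K%:R :> R by rewrite ltr0n.
have gmu m z : 0 <= g m z <= mu z.
  rewrite mulr_ge0 ?invr_ge0 ?(ltW KR) ?sumr_ge0 // => [|x _]; last exact: low_ge0.
  by rewrite ler_wpM2l ?invr_ge0 ?(ltW KR) // ler_sum // => x _; exact: low_le.
have mu1 : \sum_z mu z = 1.
  rewrite -mulr_sumr exchange_big /=.
  under eq_bigr => x _ do case: (hV x) => _ ->.
  by rewrite big_const_seq count_predT size_tuple iter_addr_0 mulVf ?gt_eqF.
have mu0 z : 0 <= mu z.
  rewrite mulr_ge0 ?invr_ge0 ?(ltW KR) ?sumr_ge0 // => x _.
  by case: (hV x).
have := @sum_uniquely_covered_le _ S A g mu mu0 gmu.
rewrite mu1 leNgt => /negP; apply; apply: lt_le_trans T1 _.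
(* Each of the [T] terms is at least [c - eta - alpha] minus [T - 1] overlaps of at most
   [2 * eta + alpha], hence at least [c - T * (2 * eta + alpha)]. *)
rewrite -{1}cS mulr_natl -sumr_const; apply: ler_sum => m mS.
have := SF _ mS; rewrite !inE => /andP[cm /eqP tm].
have := tauP m; rewrite tm -/g => dm.
set nu := output (P m) (low theta (P m) V) in dm.
have dA (C : {set Z}) : `|\sum_(z in C) g m z - \sum_(z in C) nu z| <= alpha.
  rewrite -sumrB; apply: le_trans (ler_norm_sum _ _ _) _.
  apply: le_trans dm; rewrite [leRHS](bigID (mem C)) /= lerDl.
  by apply: sumr_ge0 => z _; exact: normr_ge0.
have nuO z : nu z <= output (P m) V z.
  apply: ler_sum => x _; apply: ler_wpM2l; first by case: (dP m).
  exact: low_le.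
have nuA : c - eta <= \sum_(z in A m) nu z.
  have : c < \sum_z nu z.
    rewrite exchange_big; congr (_ < _): cm.
    by apply: eq_bigr => x _; rewrite mulr_sumr.
  rewrite (bigID (mem (A m))) /=.
  have : \sum_(z | z \notin A m) nu z <= eta.
    apply: (@le_trans _ _ (\sum_(z | z \notin A m) output (P m) V z)); first exact: ler_sum.
    have [_] := output_distr (dP m) hV.
    rewrite (bigID (mem (A m))) /=; have := A1 m; lra.
  lra.
have lo : c - eta - alpha <= \sum_(z in A m) g m z.
  by have := dA (A m); rewrite ler_norml => /andP[]; lra.
have hi : \sum_(j in S | j != m) \sum_(z in A j) g m z <=
    (T%:R - 1) * (2 * eta + alpha).
  apply: (@le_trans _ _ (\sum_(j in S | j != m) (2 * eta + alpha))).
    apply: ler_sum => j /andP[_ jm].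
    have : \sum_(z in A j) nu z <= 2 * eta.
      apply: (@le_trans _ _ (\sum_(z in A j) output (P m) V z)); first exact: ler_sum.
      by apply: A2; rewrite eq_sym.
    by have := dA (A j); rewrite ler_norml => /andP[]; lra.
  have -> : T%:R - 1 = #|[pred j | (j \in S) && (j != m)]|%:R :> R.
    rewrite -cS (cardD1 m S) mS natrD [1%:R]/= addrC addKr.
    by congr _%:R; apply: eq_card => j; rewrite !inE andbC.
  by rewrite sumr_const -[leLHS]mulr_natl lexx.
lra.
Qed.

End FewBad.

(** * Random coding *)

Section RandomCoding.
Variables (R : realType).

(* The channel from the first input to the first output when the second input is
   drawn from [Q] and the second output is discarded. *)
Definition marginal1 (X Y K L : finType) (Q : Y -> R)
    (p : X -> Y -> K * L -> R) x r : R :=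
  \sum_y Q y * \sum_s p x y (r, s).

Definition marginal2 (X Y K L : finType) (P : X -> R)
    (p : X -> Y -> K * L -> R) y s : R :=
  \sum_x P x * \sum_r p x y (r, s).

Lemma sum_pairE (K L : finType) (F : K * L -> R) :
  \sum_rs F rs = \sum_r \sum_s F (r, s).
Proof. by rewrite pair_bigA; apply: eq_bigr => -[]. Qed.

Lemma marginal1_channel (X Y K L : finType) (Q : Y -> R)
    (p : X -> Y -> K * L -> R) :
  is_distr Q -> (forall x y, is_distr (p x y)) -> is_channel (marginal1 Q p).
Proof.
move=> [Q0 Q1] dp x; split=> [r|].
  apply: sumr_ge0 => y _; rewrite mulr_ge0 // sumr_ge0 // => s _.
  by case: (dp x y).
rewrite exchange_big -Q1; apply: eq_bigr => y _; rewrite -mulr_sumr.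
by rewrite -sum_pairE; case: (dp x y) => _ ->; rewrite mulr1.
Qed.

Definition dense (X Z : finType) (theta : R) (P : X -> R) (V : X -> Z -> R) x z :=
  theta * output P V z < V x z.

(** Message sets have size [M.+1], so that [ord0] is available when no codeword passes the test. *)
Definition decode (X K : finType) M (J : X -> K -> bool) (f : 'I_M.+1 -> X) r :=
  odflt ord0 [pick m | J (f m) r].

(** A union bound: decoding fails only if the sent codeword fails the test or another codeword
    passes it. *)
Lemma decode_error (X K : finType) M (J : X -> K -> bool) (f : 'I_M.+1 -> X) r m :
  ((decode J f r != m)%:R : R) <=
  (~~ J (f m) r)%:R + \sum_(m' | m' != m) (J (f m') r)%:R.
Proof.
have s0 (P : pred 'I_M.+1) : 0 <= \sum_(m' | P m') (J (f m') r)%:R :> R.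
  by apply: sumr_ge0 => m' _; exact: ler0n.
rewrite /decode; case: pickP => [m' Jm'|nJ] /=; last first.
  by rewrite nJ /= -[leLHS]addr0 lerD // ler_nat leq_b1.
have [_|m'm] := eqVneq m' m; first by rewrite addr_ge0.
by rewrite (bigD1 m') //= Jm' addrCA -[leLHS]addr0 lerD // addr_ge0.
Qed.

(* Averaged over the codebooks, the transmitted pair is a sample of [P * Q], and
   the other codewords of the first sender are independent of the output. *)
Lemma decode_error_mean (X Y K L : finType) (P : X -> R) (Q : Y -> R)
    (p : X -> Y -> K * L -> R) (theta : R) M N (m : 'I_M.+1) (n : 'I_N) :
  is_distr P -> is_distr Q -> (forall x y, is_distr (p x y)) -> 0 < theta ->
  \sum_(f : {ffun 'I_M.+1 -> X}) (\prod_i P (f i)) *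
    \sum_(g : {ffun 'I_N -> Y}) (\prod_j Q (g j)) *
      \sum_rs p (f m) (g n) rs *
        (decode (dense theta P (marginal1 Q p)) f rs.1 != m)%:R
  <= low_mass theta P (marginal1 Q p) + M%:R / theta.
Proof.
move=> dP dQ dp t0; set V := marginal1 Q p; set J := dense theta P V.
have [P0 P1] := dP; have [Q0 Q1] := dQ.
have hV : is_channel V := marginal1_channel dQ dp.
(* The second codebook enters only through its codeword [n], a sample of [Q], so averaging over it
   produces the marginal channel. *)
have gE f : \sum_(g : {ffun 'I_N -> Y}) (\prod_j Q (g j)) *
      \sum_rs p (f m) (g n) rs * (decode J f rs.1 != m)%:R =
    \sum_r V (f m) r * (decode J f r != m)%:R.
  rewrite (prod_mean1 n (fun y => \sum_rs p (f m) y rs * (decode J f rs.1 != m)%:R) dQ).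
  under eq_bigr do rewrite sum_pairE /= mulr_sumr.
  rewrite exchange_big; apply: eq_bigr => r _.
  rewrite /V /marginal1 mulr_suml; apply: eq_bigr => y _.
  by rewrite -mulrA -mulr_suml.
under eq_bigr do rewrite gE.
have w0 (f : {ffun 'I_M.+1 -> X}) : 0 <= \prod_i P (f i) by apply: prodr_ge0.
apply: (@le_trans _ _ (\sum_(f : {ffun 'I_M.+1 -> X}) (\prod_i P (f i)) *
   (\sum_r V (f m) r * (~~ J (f m) r)%:R +
    \sum_(m' | m' != m) \sum_r V (f m) r * (J (f m') r)%:R))).
  apply: ler_sum => f _; apply: ler_wpM2l => //.
  rewrite exchange_big -big_split /=; apply: ler_sum => r _.
  rewrite -mulr_sumr -mulrDr ler_wpM2l //; last exact: decode_error.
  by case: (hV (f m)).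
under eq_bigr do rewrite mulrDr [X in _ + X]mulr_sumr.
rewrite big_split /= lerD //.
  rewrite (prod_mean1 m (fun x => \sum_r V x r * (~~ J x r)%:R) dP).
  apply: ler_sum => x _; apply: ler_wpM2l => //; apply: ler_sum => r _.
  by rewrite /J /dense /low -leNgt; case: ifP => _; rewrite ?mulr1 ?mulr0.
rewrite exchange_big /=.
apply: (@le_trans _ _ (\sum_(m' : 'I_M.+1 | m' != m) theta^-1)); last first.
  by rewrite sumr_const cardC1 card_ord /= mulr_natl.
apply: ler_sum => m' m'm.
rewrite (prod_mean2 (fun x x' => \sum_r V x r * (J x' r)%:R) dP (i := m) (j := m'));
  last by rewrite eq_sym.
rewrite exchange_big /=.
have -> : theta^-1 = \sum_x P x * theta^-1 by rewrite -mulr_suml P1 mul1r.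
apply: ler_sum => x' _.
have -> : \sum_x P x * P x' * (\sum_r V x r * (J x' r)%:R) =
    P x' * \sum_r output P V r * (J x' r)%:R.
  under eq_bigr do rewrite [P _ * P x']mulrC -mulrA.
  rewrite -mulr_sumr; congr (_ * _).
  under eq_bigr do rewrite mulr_sumr.
  rewrite exchange_big; apply: eq_bigr => r _; rewrite /output mulr_suml.
  by apply: eq_bigr => x _; rewrite mulrA.
apply: ler_wpM2l => //; have [V0 V1] := hV x'.
have -> : theta^-1 = \sum_r theta^-1 * V x' r by rewrite -mulr_sumr V1 mulr1.
apply: ler_sum => r _.
(* Change of measure: where the test for [x'] accepts, the output is at most [theta^-1 * V x' r].
   Each wrong codeword thus costs at most [theta^-1]. *)
rewrite /J /dense; case: ltP => [lt|_] /=; last by rewrite mulr0 mulr_ge0 // invr_ge0 ltW.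
by rewrite mulr1 ler_pdivlMl // ltW.
Qed.

(** The senders are decoded separately, each from its own component of the outcome, and the two
    error bounds add up. Codebooks no worse than the mean are then fixed, first [f], then [g]. *)
Lemma random_coding (X Y K L : finType) (P : X -> R) (Q : Y -> R)
    (p : X -> Y -> K * L -> R) (theta1 theta2 : R) M N :
  is_distr P -> is_distr Q -> (forall x y, is_distr (p x y)) ->
  0 < theta1 -> 0 < theta2 ->
  exists (f : 'I_M.+1 -> X) (g : 'I_N.+1 -> Y)
         (phi : K -> 'I_M.+1) (psi : L -> 'I_N.+1),
    (M.+1%:R * N.+1%:R)^-1 * \sum_m \sum_n
      \sum_rs p (f m) (g n) rs * ((phi rs.1 != m) || (psi rs.2 != n))%:R
    <= low_mass theta1 P (marginal1 Q p) + M%:R / theta1 +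
       (low_mass theta2 Q (marginal2 P p) + N%:R / theta2).
Proof.
move=> dP dQ dp t1 t2; have [P0 P1] := dP; have [Q0 Q1] := dQ.
set J1 := dense theta1 P (marginal1 Q p).
set J2 := dense theta2 Q (marginal2 P p).
set B := low_mass _ _ _ + _ + _.
pose e1 m n (f : {ffun 'I_M.+1 -> X}) (g : {ffun 'I_N.+1 -> Y}) :=
  \sum_rs p (f m) (g n) rs * (decode J1 f rs.1 != m)%:R.
pose e2 m n (f : {ffun 'I_M.+1 -> X}) (g : {ffun 'I_N.+1 -> Y}) :=
  \sum_rs p (f m) (g n) rs * (decode J2 g rs.2 != n)%:R.
pose e m n (f : {ffun 'I_M.+1 -> X}) (g : {ffun 'I_N.+1 -> Y}) :=
  \sum_rs p (f m) (g n) rs *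
    ((decode J1 f rs.1 != m) || (decode J2 g rs.2 != n))%:R.
pose E (h : {ffun 'I_M.+1 -> X} -> {ffun 'I_N.+1 -> Y} -> R) :=
  \sum_(f : {ffun 'I_M.+1 -> X}) (\prod_i P (f i)) *
    \sum_(g : {ffun 'I_N.+1 -> Y}) (\prod_j Q (g j)) * h f g.
have wP := prod_distr 'I_M.+1 dP; have wQ := prod_distr 'I_N.+1 dQ.
have E_e m n : E (e m n) <= B.
  apply: (@le_trans _ _ (E (e1 m n) + E (e2 m n))).
    rewrite -big_split; apply: ler_sum => f _ /=; rewrite -mulrDr.
    apply: ler_wpM2l; first by case: wP.
    rewrite -big_split; apply: ler_sum => g _ /=; rewrite -mulrDr.
    apply: ler_wpM2l; first by case: wQ.
    rewrite -big_split; apply: ler_sum => rs _ /=; rewrite -mulrDr.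
    apply: ler_wpM2l; first by case: (dp (f m) (g n)).
    by rewrite -natrD ler_nat; case: (_ != _); case: (_ != _).
  apply: lerD; first exact: decode_error_mean.
  have -> : E (e2 m n) =
    \sum_(g : {ffun 'I_N.+1 -> Y}) (\prod_j Q (g j)) *
    \sum_(f : {ffun 'I_M.+1 -> X}) (\prod_i P (f i)) *
      \sum_(sr : L * K) p (f m) (g n) (sr.2, sr.1) * (decode J2 g sr.1 != n)%:R.
    rewrite /E; under eq_bigr do rewrite mulr_sumr.
    rewrite exchange_big; apply: eq_bigr => g _; rewrite mulr_sumr.
    apply: eq_bigr => f _; rewrite mulrCA; congr (_ * (_ * _)).
    rewrite /e2 (reindex (fun sr : L * K => (sr.2, sr.1))) //=.
    by exists (fun rs : K * L => (rs.2, rs.1)) => -[].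
  (* The second sender is the first one for the channel with inputs and outcome components
     exchanged. *)
  apply: (@decode_error_mean Y X L K Q P (fun y x sr => p x y (sr.2, sr.1))) => //.
  move=> y x; have [p0 p1] := dp x y; split=> [sr|]; first exact: p0.
  rewrite -p1 [RHS](reindex (fun sr : L * K => (sr.2, sr.1))) //=.
  by exists (fun rs : K * L => (rs.2, rs.1)) => -[].
pose a f g := (M.+1%:R * N.+1%:R)^-1 * \sum_m \sum_n e m n f g.
have E_a : E a <= B.
  have -> : E a = (M.+1%:R * N.+1%:R)^-1 * \sum_m \sum_n E (e m n).
    rewrite /E.
    under eq_bigr do rewrite mulr_sumr.
    transitivity (\sum_(f : {ffun 'I_M.+1 -> X}) \sum_(g : {ffun 'I_N.+1 -> Y})
      (M.+1%:R * N.+1%:R)^-1 * \sum_m \sum_n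
       \prod_i P (f i) * (\prod_j Q (g j) * e m n f g)).
      apply: eq_bigr => f _; apply: eq_bigr => g _; rewrite /a.
      rewrite (mulrCA (\prod_j Q (g j))) (mulrCA (\prod_i P (f i))); congr (_ * _).
      rewrite !mulr_sumr; apply: eq_bigr => m _.
      by rewrite !mulr_sumr.
    under eq_bigr do rewrite -mulr_sumr.
    rewrite -mulr_sumr; congr (_ * _).
    under eq_bigr do rewrite exchange_big.
    rewrite exchange_big; apply: eq_bigr => m _ /=.
    under eq_bigr do rewrite exchange_big.
    rewrite exchange_big; apply: eq_bigr => n _ /=.
    by apply: eq_bigr => f _; rewrite mulr_sumr.
  apply: (@le_trans _ _ ((M.+1%:R * N.+1%:R)^-1 * \sum_(m < M.+1) \sum_(n < N.+1) B)).
    apply: ler_wpM2l; first by rewrite invr_ge0 mulr_ge0.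
    by apply: ler_sum => m _; apply: ler_sum => n _.
  rewrite !sumr_const !card_ord -mulrnA -[B *+ _]mulr_natr natrM.
  by rewrite mulrCA [N.+1%:R * _]mulrC mulVf ?mulr1 // mulf_neq0 // pnatr_eq0.
have [f /(exists_le_mean wQ)[g fg]] := exists_le_mean wP E_a.
by exists f, g, (decode J1 f), (decode J2 g).
Qed.

End RandomCoding.

(** * From identification to transmission *)

Section Converse.
Variable R : realType.

(** Double counting: each kind of badness affects at most a quarter of all pairs, so at least half
    of the pairs are free of both. *)
Lemma exists_good_pair (M N : nat) (b1 b2 : 'I_M -> 'I_N -> bool) :
  (0 < M)%N -> (0 < N)%N ->
  (forall n, 4 * #|[set m | b1 m n]| <= M)%N ->
  (forall m, 4 * #|[set n | b2 m n]| <= N)%N ->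
  exists m n, ~~ b1 m n && ~~ b2 m n.
Proof.
move=> M0 N0 h1 h2; case: (boolP [exists m, exists n, ~~ b1 m n && ~~ b2 m n]).
  by case/existsP=> m /existsP[n mn]; exists m, n.
rewrite negb_exists => /forallP all_bad.
have cover m n : (1 <= b1 m n + b2 m n)%N.
  have := all_bad m; rewrite negb_exists => /forallP/(_ n).
  by rewrite -negb_or negbK; case: (b1 m n); case: (b2 m n).
have s1 n : (\sum_m b1 m n = #|[set m | b1 m n]|)%N.
  by rewrite -sum1_card [RHS]big_mkcond; apply: eq_bigr => m _;
    rewrite inE; case: (b1 m n).
have s2 m : (\sum_n b2 m n = #|[set n | b2 m n]|)%N.
  by rewrite -sum1_card [RHS]big_mkcond; apply: eq_bigr => n _;
    rewrite inE; case: (b2 m n).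
have : (4 * (M * N) <= 2 * (M * N))%N.
  apply: (@leq_trans (4 * \sum_m \sum_n (b1 m n + b2 m n))).
    rewrite leq_mul2l /=.
    have {1}-> : (M * N = \sum_(m < M) \sum_(n < N) 1)%N.
      by rewrite !sum_nat_const !card_ord muln1.
    by apply: leq_sum => m _; apply: leq_sum.
  under eq_bigr do rewrite big_split /=.
  rewrite big_split /= exchange_big /=.
  under eq_bigr do rewrite s1.
  under [X in (_ + X)%N]eq_bigr do rewrite s2.
  rewrite mulnDr !big_distrr /= mul2n -addnn leq_add //.
    apply: (@leq_trans (\sum_(n < N) M)); first exact: leq_sum.
    by rewrite sum_nat_const card_ord mulnC.
  apply: (@leq_trans (\sum_(m < M) N)); first exact: leq_sum.
  by rewrite sum_nat_const card_ord.
by rewrite leq_pmul2r ?muln_gt0 ?M0.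
Qed.

Definition pair_output (X Y K L : finType) (P : X -> R) (Q : Y -> R)
    (p : X -> Y -> K * L -> R) rs : R :=
  \sum_x \sum_y P x * Q y * p x y rs.

Lemma output_marginal1 (X Y K L : finType) (P : X -> R) (Q : Y -> R)
    (p : X -> Y -> K * L -> R) r :
  output P (marginal1 Q p) r = \sum_s pair_output P Q p (r, s).
Proof.
rewrite /output /marginal1 /pair_output exchange_big; apply: eq_bigr => x _.
rewrite exchange_big mulr_sumr; apply: eq_bigr => y _.
by rewrite mulrA mulr_sumr.
Qed.

Lemma pair_output_ge0 (X Y K L : finType) (P : X -> R) (Q : Y -> R)
    (p : X -> Y -> K * L -> R) rs :
  is_distr P -> is_distr Q -> (forall x y, is_distr (p x y)) ->
  0 <= pair_output P Q p rs.
Proof.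
move=> [P0 _] [Q0 _] dp; apply: sumr_ge0 => x _; apply: sumr_ge0 => y _.
by rewrite !mulr_ge0 //; case: (dp x y).
Qed.

(** The marginal channel ignores the condition [s \in B]. Dropping it costs at most [eta], because
    the correct test already finds mass [1 - eta] inside [B]; hence the overlap bound [2 * eta] in
    [card_low_mass_le]. *)
Lemma few_bad_messages (X Y K L : finType) (M : nat) (P : 'I_M -> X -> R)
    (Q : Y -> R) (p : X -> Y -> K * L -> R) (A : 'I_M -> {set K}) (B : {set L})
    (theta alpha eta c : R) (T : nat) :
  (forall m, is_distr (P m)) -> is_distr Q -> (forall x y, is_distr (p x y)) ->
  0 < theta -> 0 < alpha -> 0 <= eta ->
  (forall m, 1 - eta <=
    \sum_(r in A m) \sum_(s in B) pair_output (P m) Q p (r, s)) ->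
  (forall m m', m != m' ->
    \sum_(r in A m') \sum_(s in B) pair_output (P m) Q p (r, s) <= eta) ->
  1 < T%:R * (c - T%:R * (2 * eta + alpha)) ->
  theta <= c \/ (exists2 K, (0 < K)%N & theta <= K%:R * alpha ^+ 2 /\
    (4 * (#|X| ^ K * T) <= M)%N) ->
  (4 * #|[set m | (c < low_mass theta (P m) (marginal1 Q p))%R]| <= M)%N.
Proof.
move=> dP dQ dp t0 a0 e0 A1 A2 T1 hyp.
have hV : is_channel (marginal1 Q p) := marginal1_channel dQ dp.
have o0 m rs := pair_output_ge0 rs (dP m) dQ dp.
case: hyp => [tc|[n n0 [tn nM]]].
  rewrite eq_card0 ?muln0 // => m; rewrite !inE; apply/negbTE; rewrite -leNgt.
  by apply: le_trans tc; apply: low_mass_le => //; exact: ltW.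
apply: leq_trans nM; rewrite leq_mul2l /=.
have outE m (C : {set K}) : \sum_(r in C) output (P m) (marginal1 Q p) r =
    \sum_(r in C) \sum_(s in B) pair_output (P m) Q p (r, s) +
    \sum_(r in C) \sum_(s | s \notin B) pair_output (P m) Q p (r, s).
  rewrite -big_split; apply: eq_bigr => r _ /=.
  by rewrite output_marginal1 (bigID (mem B)).
have s0 m (C : {set K}) :
    0 <= \sum_(r in C) \sum_(s | s \notin B) pair_output (P m) Q p (r, s).
  by apply: sumr_ge0 => r _; apply: sumr_ge0 => s _; exact: o0.
apply: (@card_low_mass_le R X K M P A _ theta alpha eta c n T) => //.
- by move=> m; rewrite outE (le_trans (A1 m)) // lerDl.
- move=> m m' mm'; rewrite outE.
  have := A2 _ _ mm'.
  suff : \sum_(r in A m') \sum_(s | s \notin B) pair_output (P m) Q p (r, s) <= eta.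
    lra.
  apply: (@le_trans _ _ (\sum_r \sum_(s | s \notin B) pair_output (P m) Q p (r, s))).
    rewrite [leRHS](bigID (mem (A m'))) /= lerDl.
    by apply: sumr_ge0 => r _; apply: sumr_ge0 => s _; exact: o0.
  have := A1 m; have [_] := output_distr (dP m) hV.
  have -> : \sum_r output (P m) (marginal1 Q p) r =
     \sum_r \sum_(s in B) pair_output (P m) Q p (r, s) +
     \sum_r \sum_(s | s \notin B) pair_output (P m) Q p (r, s).
    rewrite -big_split; apply: eq_bigr => r _ /=.
    by rewrite output_marginal1 (bigID (mem B)).
  have : \sum_(r in A m) \sum_(s in B) pair_output (P m) Q p (r, s) <=
         \sum_r \sum_(s in B) pair_output (P m) Q p (r, s).
    rewrite [leRHS](bigID (mem (A m))) /= lerDl.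
    by apply: sumr_ge0 => r _; apply: sumr_ge0 => s _; exact: o0.
  lra.
Qed.

(** Fixing [n] bounds the bad [m], and fixing [m] bounds the bad [n] after the senders are
    exchanged. [exists_good_pair] combines the two counts. *)
Lemma sim_id_code_good_pair (X Y K L : finType) (M N : nat)
    (P : 'I_M -> X -> R) (Q : 'I_N -> Y -> R) (p : X -> Y -> K * L -> R)
    (A : 'I_M -> {set K}) (B : 'I_N -> {set L})
    (theta1 theta2 alpha eta c : R) (T : nat) :
  (0 < M)%N -> (0 < N)%N ->
  (forall m, is_distr (P m)) -> (forall n, is_distr (Q n)) ->
  (forall x y, is_distr (p x y)) ->
  0 < theta1 -> 0 < theta2 -> 0 < alpha -> 0 <= eta ->
  let a (mn mn' : 'I_M * 'I_N) := \sum_(r in A mn'.1) \sum_(s in B mn'.2)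
    pair_output (P mn.1) (Q mn.2) p (r, s) in
  (forall mn, (1 - eta <= a mn mn)%R) ->
  (forall mn mn', mn != mn' -> (a mn mn' <= eta)%R) ->
  1 < T%:R * (c - T%:R * (2 * eta + alpha)) ->
  theta1 <= c \/ (exists2 K, (0 < K)%N & theta1 <= K%:R * alpha ^+ 2 /\
    (4 * (#|X| ^ K * T) <= M)%N) ->
  theta2 <= c \/ (exists2 K, (0 < K)%N & theta2 <= K%:R * alpha ^+ 2 /\
    (4 * (#|Y| ^ K * T) <= N)%N) ->
  exists m n, low_mass theta1 (P m) (marginal1 (Q n) p) <= c /\
              low_mass theta2 (Q n) (marginal2 (P m) p) <= c.
Proof.
move=> M0 N0 dP dQ dp t1 t2 a0 e0 a a1 a2 T1 h1 h2.
have [||m [n]] := @exists_good_pair M N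
  (fun m n => c < low_mass theta1 (P m) (marginal1 (Q n) p))
  (fun m n => c < low_mass theta2 (Q n) (marginal2 (P m) p)) M0 N0.
- move=> n; apply: (few_bad_messages (A := A) (B := B n) dP (dQ n) dp t1 a0 e0 _ _ T1) => //.
    by move=> m; exact: (a1 (m, n)).
  move=> m m' mm'; apply: (a2 (m, n) (m', n)).
  by rewrite xpair_eqE negb_and mm'.
- move=> m; pose q y x (sr : L * K) := p x y (sr.2, sr.1).
  have dq y x : is_distr (q y x).
    have [p0 p1] := dp x y; split=> [sr|]; first exact: p0.
    rewrite -p1 [RHS](reindex (fun sr : L * K => (sr.2, sr.1))) //=.
    by exists (fun rs : K * L => (rs.2, rs.1)) => -[].
  have oE n r s : pair_output (Q n) (P m) q (s, r) = pair_output (P m) (Q n) p (r, s).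
    rewrite /pair_output exchange_big; apply: eq_bigr => x _; apply: eq_bigr => y _.
    by rewrite [Q n y * _]mulrC.
  apply: (few_bad_messages (A := B) (B := A m) dQ (dP m) dq t2 a0 e0 _ _ T1) => //.
    move=> n; apply: (le_trans (a1 (m, n))); rewrite /a /= exchange_big.
    by apply: ler_sum => s _; apply: ler_sum => r _; rewrite oE.
  move=> n n' nn'; apply: le_trans (a2 (m, n) (m, n') _).
    rewrite /a /= exchange_big.
    by apply: ler_sum => s _; apply: ler_sum => r _; rewrite oE.
  by rewrite xpair_eqE negb_and nn' orbT.
by rewrite -!leNgt => /andP[? ?]; exists m, n.
Qed.

End Converse.

(** * Transmission codes from the simultaneous measurement *)

Section Decoding.
Variables (R : realType) (X Y : finType) (d : nat).

Definition merge (I J K L : finType) n (E : K -> L -> 'M[R[i]%C]_n)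
    (phi : K -> I) (psi : L -> J) i j :=
  \sum_(rs : K * L | (phi rs.1 == i) && (psi rs.2 == j)) E rs.1 rs.2.

Lemma merge_povm (I J K L : finType) n (E : K -> L -> 'M[R[i]%C]_n)
    (phi : K -> I) (psi : L -> J) :
  povm (fun rs : K * L => E rs.1 rs.2) ->
  povm (fun ij : I * J => merge E phi psi ij.1 ij.2).
Proof.
case=> pE sE; split=> [ij|]; first by apply: psd_sum.
rewrite -sE (partition_big (fun rs => (phi rs.1, psi rs.2)) xpredT) //.
Qed.

Lemma merge_error (I J K L : finType) n (E : K -> L -> 'M[R[i]%C]_n)
    (phi : K -> I) (psi : L -> J) (rho : state R n) i j :
  povm (fun rs : K * L => E rs.1 rs.2) ->
  1 - prob (merge E phi psi i j) rho =
  \sum_rs prob (E rs.1 rs.2) rho * ((phi rs.1 != i) || (psi rs.2 != j))%:R.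
Proof.
move=> pE; have [_ p1] := povm_distr rho pE; rewrite prob_sum -[X in X - _]p1.
rewrite (bigID (fun rs => (phi rs.1 == i) && (psi rs.2 == j))) /= addrAC subrr add0r.
rewrite big_mkcond; apply: eq_bigr => rs _; rewrite -negb_and.
by case: (_ && _) => /=; rewrite ?mulr0 ?mulr1.
Qed.

(** Simultaneity supplies one POVM whose outcome statistics form a classical channel [p]. Classical
    decoders found for [p] are applied to its outcomes, which merges the POVM into that of the new
    code. *)
Lemma sim_id_code_to_code (k M N : nat) (c : id_code R X Y d k M N)
    (Wk : k.-tuple X -> k.-tuple Y -> state R (tdim d k))
    (theta1 theta2 alpha eta cc : R) (T M' N' : nat) :
  (0 < M)%N -> (0 < N)%N -> simultaneous c ->
  id_error1 c Wk <= eta -> id_error2 c Wk <= eta ->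
  0 < theta1 -> 0 < theta2 -> 0 < alpha -> 0 <= eta ->
  1 < T%:R * (cc - T%:R * (2 * eta + alpha)) ->
  theta1 <= cc \/ (exists2 K, (0 < K)%N & theta1 <= K%:R * alpha ^+ 2 /\
    (4 * (#|{: k.-tuple X}| ^ K * T) <= M)%N) ->
  theta2 <= cc \/ (exists2 K, (0 < K)%N & theta2 <= K%:R * alpha ^+ 2 /\
    (4 * (#|{: k.-tuple Y}| ^ K * T) <= N)%N) ->
  exists c' : code R X Y d k M'.+1 N'.+1,
    avg_error c' Wk <= cc + M'%:R / theta1 + (cc + N'%:R / theta2).
Proof.
move=> M0 N0 [K [L [E [A [B [pE tE]]]]]] err1 err2 t1 t2 a0 e0 T1 h1 h2.
pose p x y (rs : 'I_K * 'I_L) := prob (E rs.1 rs.2) (Wk x y).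
have dp x y : is_distr (p x y) by exact: povm_distr.
have accE mn mn' : id_accept c Wk mn mn' = \sum_(r in A mn'.1) \sum_(s in B mn'.2)
    pair_output (id_enc1 c mn.1) (id_enc2 c mn.2) p (r, s).
  rewrite /id_accept /pair_output.
  under [RHS]eq_bigr do rewrite exchange_big.
  rewrite [RHS]exchange_big; apply: eq_bigr => x _ /=.
  under [RHS]eq_bigr do rewrite exchange_big.
  rewrite [RHS]exchange_big; apply: eq_bigr => y _ /=.
  rewrite tE prob_sum mulr_sumr; apply: eq_bigr => r _.
  by rewrite prob_sum mulr_sumr.
have [m [n [lm ln]]] : exists m n,
    low_mass theta1 (id_enc1 c m) (marginal1 (id_enc2 c n) p) <= cc /\
    low_mass theta2 (id_enc2 c n) (marginal2 (id_enc1 c m) p) <= cc.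
  apply: (sim_id_code_good_pair (A := A) (B := B) M0 N0 (id_enc1_distr c)
    (id_enc2_distr c) dp t1 t2 a0 e0 _ _ T1 h1 h2) => [mn|mn mn' mnn'].
    rewrite -accE lerBlDl -lerBlDr; apply: le_trans err1.
    exact: (le_bigmax _ (fun mn => 1 - id_accept c Wk mn mn)).
  rewrite -accE; apply: le_trans err2.
  exact: (le_bigmax_cond 0 (fun q => id_accept c Wk q.1 q.2) (j := (mn, mn')) mnn').
have [f [g [phi [psi fg]]]] := random_coding M' N' (id_enc1_distr c m)
   (id_enc2_distr c n) dp t1 t2.
exists (Code f g (merge_povm phi psi pE)); rewrite /avg_error /=.
apply: (le_trans _ (lerD (lerD lm (lexx _)) (lerD ln (lexx _)))).
apply: le_trans fg; rewrite le_eqVlt; apply/orP; left; apply/eqP.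
transitivity ((M'.+1%:R * N'.+1%:R)^-1 * \sum_m \sum_n
    (1 - prob (merge E phi psi m n) (Wk (f m) (g n)))); last first.
  by congr (_ * _); apply: eq_bigr => m' _; apply: eq_bigr => n' _; rewrite merge_error.
under [X in _ = _ * X]eq_bigr do rewrite sumrB sumr_const card_ord.
rewrite sumrB sumr_const card_ord -mulrnA mulnC natrM mulrBr mulVf //.
by rewrite mulf_neq0 // pnatr_eq0.
Qed.

End Decoding.

(** * Asymptotics of the code sizes *)

Section Rates.
Variable R : realType.

Lemma ln2_gt0 : 0 < ln 2 :> R.
Proof. by rewrite ln_gt0 // ltr1n. Qed.

Lemma log2_ge_nat (e M : nat) :
  (0 < M)%N -> e%:R <= log2 M%:R :> R -> (2 ^ e <= M)%N.
Proof.
move=> M0; rewrite /log2 ler_pdivlMr ?ln2_gt0 // mulr_natl -lnXn ?ltr0n //.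
by rewrite ler_ln ?posrE ?exprn_gt0 ?ltr0n // -natrX ler_nat.
Qed.

Lemma log2_ge (x a : R) : expR (a * ln 2) <= x -> a <= log2 x.
Proof.
move=> le_x; rewrite /log2 ler_pdivlMr ?ln2_gt0 //.
rewrite -[leLHS]expRK ler_ln ?posrE ?expR_gt0 //.
exact: lt_le_trans (expR_gt0 _) le_x.
Qed.

Lemma log2_le (x a : R) : 0 < x -> a <= log2 x -> expR (a * ln 2) <= x.
Proof.
by move=> x0; rewrite /log2 ler_pdivlMr ?ln2_gt0 // -[X in _ -> _ <= X]lnK ?posrE // ler_expR.
Qed.

(** As [ln] vanishes on nonpositive reals, a positive lower bound on [log2 x] already implies
    [0 < x]. This serves for [x = log2 M], which is 0 at [M = 1]. *)
Lemma log2_gt0_ge (x a : R) : 0 < a -> a <= log2 x -> expR (a * ln 2) <= x.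
Proof.
move=> a0 ax; have [x0|x0] := ltP 0 x; first exact: log2_le.
by move: ax; rewrite /log2 ln0 // mul0r leNgt a0.
Qed.

Lemma linear_le_expR (C a : R) : 0 < a -> exists k0 : nat, forall k : nat,
  (* The quadratic term of the exponential series suffices once [k] is at least [2 * C / a ^+ 2]. *)
  (k0 <= k)%N -> C * k%:R <= expR (k%:R * a).
Proof.
move=> a0; exists (Num.trunc (2 * C / a ^+ 2)).+1 => k kk.
have ak : 2 * C / a ^+ 2 <= k%:R.
  have [x0|x0] := leP 0 (2 * C / a ^+ 2); last exact: le_trans (ltW x0) _.
  have /andP[_ /ltW/le_trans] := truncn_itv x0; apply.
  by rewrite ler_nat.
rewrite ler_pdivrMr ?exprn_gt0 // in ak.
have k0 : 0 <= k%:R :> R by exact: ler0n.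
have := @expR_ge1Dxn R (k%:R * a) 1 (mulr_ge0 k0 (ltW a0)).
rewrite !factS fact0 !muln1; apply: le_trans.
nra.
Qed.

Lemma expn_mul_le_expn2 (b T k K : nat) : (0 < k)%N -> (0 < K)%N ->
  (4 * ((b ^ k) ^ K * T) <= 2 ^ ((b + T + 2) * k * K))%N.
Proof.
move=> k0 K0; have kK : (0 < k * K)%N by rewrite muln_gt0 k0.
apply: (@leq_trans (2 ^ (2 + (b * (k * K) + T)))).
  rewrite expnD (expnD 2 (b * (k * K))); apply: leq_mul; first by [].
  apply: leq_mul; last exact/ltnW/ltn_expl.
  rewrite -expnM (expnM 2) leq_exp2r //; exact/ltnW/ltn_expl.
rewrite leq_exp2l // -mulnA !mulnDl addnC leq_add ?leq_pmulr //.
by rewrite leq_add2l leq_pmulr.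
Qed.

(** [M] is doubly exponential, at least 2 to the power [2 ^ (k * (r - delta / 2))]. The covering
    tuples number [b ^ (k * K)] with [K] of order [2 ^ (k * (r - delta))], and the slack [delta / 2]
    absorbs the factor [k] and the constants. *)
Lemma choose_sizes (b T : nat) (r delta c alpha : R) :
  0 < delta -> 0 < c -> 0 < alpha ->
  exists k0 : nat, forall k : nat, (k0 <= k)%N -> forall M : nat, (0 < M)%N ->
  k%:R^-1 * log2 (log2 M%:R) >= r - delta / 2 ->
  exists (M' : nat) (theta : R),
    [/\ 0 < theta, k%:R^-1 * log2 M'.+1%:R >= r - delta,
        M'%:R / theta <= c &
        theta <= c \/ (exists2 K, (0 < K)%N & theta <= K%:R * alpha ^+ 2 /\
          (4 * ((b ^ k) ^ K * T) <= M)%N)].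
Proof.
move=> d0 c0 a0; have l2 := ln2_gt0.
(* For a nonpositive target one message suffices, and [theta = c] requires nothing of [M]. *)
have [r0|r0] := leP (r - delta) 0.
  exists 0%N => k _ M _ _; exists 0%N, c; split=> //; last by left.
    by rewrite /log2 ln1 mul0r mulr0.
  by rewrite mul0r ltW.
(* Since [1 <= E], the length [K <= theta / alpha ^+ 2 + 1] is at most [E * C1]. *)
pose C1 : R := (c * alpha ^+ 2)^-1 + 1.
pose D := (b + T + 2)%N.
have [k0 k0P] := @linear_le_expR (D%:R * C1) (delta / 2 * ln 2)
  (mulr_gt0 (divr_gt0 d0 (ltr0Sn _ 1)) l2).
exists k0.+1 => k kk M M0 hM.
have kpos : 0 < k%:R :> R by rewrite ltr0n; exact: leq_trans kk.
pose E : R := expR (k%:R * (r - delta) * ln 2).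
have E0 : 0 < E := expR_gt0 _.
have E1 : 1 <= E by rewrite (le_trans _ (expR_ge1Dx _)) // lerDl !mulr_ge0 // ltW.
have /andP[trE Etr] := truncn_itv (ltW E0).
pose theta := E / c.
have t0 : 0 < theta by exact: divr_gt0.
(* Truncation gives [M' <= E < M'.+1]: the upper bound serves the rate, and the lower one gives
   [M' / theta <= c]. *)
exists (Num.trunc E), theta; split=> //.
- rewrite ler_pdivlMl //; apply: log2_ge; exact: ltW.
- by rewrite ler_pdivrMr // /theta mulrCA mulfV ?gt_eqF // mulr1.
right.
have [K [K0 tK Kt]] : exists K, [/\ (0 < K)%N, theta <= K%:R * alpha ^+ 2 &
    K%:R <= theta / alpha ^+ 2 + 1].
  have ta0 : 0 <= theta / alpha ^+ 2 by rewrite divr_ge0 ?sqr_ge0 // ltW.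
  have /andP[Kle Klt] := truncn_itv ta0.
  exists (Num.trunc (theta / alpha ^+ 2)).+1; split=> //.
    by rewrite -ler_pdivrMr ?exprn_gt0 // ltW.
  by rewrite -natr1 lerD2r.
exists K => //; split=> //.
have kN : (0 < k)%N by exact: leq_trans kk.
apply: leq_trans (expn_mul_le_expn2 b T kN K0) _.
apply: (log2_ge_nat M0).
have lM : expR (k%:R * (r - delta / 2) * ln 2) <= log2 M%:R.
  apply: log2_gt0_ge; last by rewrite -ler_pdivlMl.
  by rewrite mulr_gt0 //; lra.
apply: le_trans lM.
have -> : k%:R * (r - delta / 2) * ln 2 =
   k%:R * (r - delta) * ln 2 + k%:R * (delta / 2 * ln 2) by field.
rewrite expRD -/E.
apply: (@le_trans _ _ (E * (D%:R * C1 * k%:R))); last first.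
  by rewrite ler_wpM2l ?(ltW E0) // k0P // ltnW.
rewrite -/D !natrM [leRHS](_ : _ = D%:R * k%:R * (E * C1)); last by ring.
apply: ler_wpM2l; first exact: mulr_ge0.
apply: le_trans Kt _.
have -> : theta / alpha ^+ 2 = E * (c * alpha ^+ 2)^-1 by rewrite /theta; field; rewrite !gt_eqF.
by rewrite /C1 mulrDr mulr1 lerD2l.
Qed.

End Rates.

Section Inclusion.
Variables (R : realType) (X Y : finType) (d : nat).

Lemma sim_id_achievable_achievable (W : ccq_channel R X Y d) (r : R * R) :
  sim_id_achievable W r -> achievable W r.
Proof.
move=> hW eps delta eps0 d0.
(* The error bound of [sim_id_code_to_code] has four terms, each made at most [c]. *)
pose c := eps / 4; have c0 : 0 < c by exact: divr_gt0.
(* Here [T * c > 2], and [alpha] and [eta] are set so that [T * (2 * eta + alpha) = c / 2]; the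
   product required to exceed 1 is then [T * c / 2]. *)
pose T := (Num.trunc (2 / c)).+1.
have Tc : 2 < T%:R * c.
  by rewrite -ltr_pdivrMr //; have /andP[] := truncn_itv (ltW (divr_gt0 (ltr0Sn R 1) c0)).
have T0 : 0 < T%:R :> R by rewrite ltr0n.
pose alpha := c / (4 * T%:R); pose eta := c / (8 * T%:R).
have a0 : 0 < alpha by rewrite divr_gt0 // mulr_gt0.
have e0 : 0 < eta by rewrite divr_gt0 // mulr_gt0.
have TT : 1 < T%:R * (c - T%:R * (2 * eta + alpha)).
  have -> : T%:R * (2 * eta + alpha) = c / 2 by rewrite /eta /alpha; field; rewrite gt_eqF.
  by nra.
have [k1 k1P] := hW _ _ _ e0 e0 (divr_gt0 d0 (ltr0Sn R 1)).
have [k2 k2P] := choose_sizes #|X| T r.1 d0 c0 a0.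
have [k3 k3P] := choose_sizes #|Y| T r.2 d0 c0 a0.
exists (maxn k1 (maxn k2 k3)) => k; rewrite !geq_max => /and3P[kk1 kk2 kk3].
have [M [N [M0 N0 [cid [sim [r1 r2 err1 err2]]]]]] := k1P k kk1.
have [M' [theta1 [t1 R1 s1 h1]]] := k2P k kk2 M M0 r1.
have [N' [theta2 [t2 R2 s2 h2]]] := k3P k kk3 N N0 r2.
exists M'.+1, N'.+1; split=> //.
rewrite -card_tuple in h1; rewrite -card_tuple in h2.
have [c' c'P] := sim_id_code_to_code M' N' M0 N0 sim err1 err2 t1 t2 a0 (ltW e0) TT h1 h2.
exists c'; split=> //; apply: le_trans c'P _.
have -> : eps = c + c + (c + c) by rewrite /c; field.
by rewrite !lerD.
Qed.

End Inclusion.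

(** * From transmission to identification *)

Section Packing.
Local Open Scope nat_scope.

(** A greedy choice: fewer than [M] chosen elements exclude fewer than [M * B] elements of [T], so
    another one can be added. *)
Lemma pairwise_unrelated (T : finType) (e : rel T) (B M : nat) :
  symmetric e -> 0 < B -> (forall x, #|[set y | e x y]| <= B) ->
  M * B <= #|T| ->
  exists f : 'I_M -> T, forall i j, i != j -> ~~ e (f i) (f j).
Proof.
move=> se B0 eB MB.
suff [s sM sp] : exists2 s : seq T, size s = M & pairwise (fun x y => ~~ e x y) s.
  have [x0 _|T0] := pickP (@predT T); last first.
    have M0 : M = 0.
      by apply/eqP; move: MB; rewrite eq_card0 // leqn0 muln_eq0 (gtn_eqF B0) orbF.
    have no (i : 'I_M) : False by case: i; rewrite M0.
    by exists (fun i => False_rect _ (no i)) => i; case: (no i).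
  exists (fun i => nth x0 s i) => i j ij.
  wlog lt_ij : i j ij / i < j => [hw|].
    case: (ltngtP i j) => [|ji|/val_inj eij]; first exact: hw.
      by rewrite se; apply: hw => //; rewrite eq_sym.
    by rewrite eij eqxx in ij.
  by move/(pairwiseP x0): sp; apply; rewrite ?inE ?sM.
elim: M MB => [|M IHM] MB; first by exists [::].
have [s sM sp] := IHM (leq_trans (leq_mul (leqnSn M) (leqnn B)) MB).
have cov : #|[set x | has (fun y => e y x) s]| <= size s * B.
  elim: (s) => [|y s' IHs] /=.
    by rewrite eq_card0 // => x; rewrite inE.
  rewrite mulSn; apply: leq_trans (leq_add (eB y) IHs).
  rewrite -cardsUI; apply: (leq_trans _ (leq_addr _ _)).
  by apply: subset_leq_card; apply/fintype.subsetP => x; rewrite !inE.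
have : #|[set x | has (fun y => e y x) s]| < #|T|.
  apply: leq_ltn_trans cov _; apply: leq_trans MB; rewrite sM.
  by rewrite ltn_mul2r B0 /=.
rewrite -(cardsC [set x | has (fun y => e y x) s]) -[ltnLHS]addn0 ltn_add2l.
move=> /card_gt0P[x]; rewrite !inE => /hasPn nx.
exists (x :: s); first by rewrite /= sM.
rewrite /= sp andbT; apply/allP => y ys; rewrite se; exact: nx.
Qed.

Lemma card_ffun_fixed (L q : nat) (u : {ffun 'I_L -> 'I_q}) (S : {set 'I_L}) :
  #|[set v : {ffun 'I_L -> 'I_q} | [forall l in S, v l == u l]]| = q ^ (L - #|S|).
Proof.
pose F l : pred 'I_q := if l \in S then pred1 (u l) else predT.
rewrite (eq_card (B := family F)) => [|v]; last first.
  rewrite inE; apply/forallP/familyP => h l; have := h l; rewrite /F.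
    by case: (l \in S) => //= /eqP ->; rewrite inE.
  by case: (l \in S) => //=.
rewrite card_family foldrE big_map big_enum /= (bigID (mem S)) /=.
rewrite big1 => [|l lS]; last by rewrite /F lS card1.
rewrite mul1n (eq_bigr (fun=> q)) => [|l /negPf lS]; last first.
  by rewrite /F lS card_ord.
have CS : #|S| + #|~: S| = L by rewrite cardsC card_ord.
rewrite prod_nat_const; congr (_ ^ _); transitivity #|~: S|.
  by apply: eq_card => l; rewrite !inE.
by rewrite -[LHS](addKn #|S|) CS.
Qed.

(* Gilbert's bound: over an alphabet of size [4 ^ t], at most [2 ^ L] sets of
   coordinates can be the agreement set, and fixing [L / t] coordinates divides
   the number of words by at least [4 ^ L]. *)
Lemma words_rarely_agreeing (L t : nat) : 0 < t ->
  exists f : 'I_(2 ^ L) -> {ffun 'I_L -> 'I_(4 ^ t)},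
    forall i j, i != j -> t * #|[set l | f i l == f j l]| <= L.
Proof.
move=> t0; have qE : 4 ^ t = 2 ^ (2 * t) by rewrite expnM.
move: (4 ^ t) qE => q qE.
pose agree (u v : {ffun 'I_L -> 'I_q}) := [set l | u l == v l].
pose e (u v : {ffun 'I_L -> 'I_q}) := L <= t * #|agree u v|.
(* The radius condition is tuned so that [2 ^ L] balls of this size account for exactly the
   [2 ^ (2 * t * L)] words. *)
have [|||| f fP] := @pairwise_unrelated _ e (2 ^ (2 * t * L - L)) (2 ^ L).
- move=> u v; rewrite /e; congr (_ <= _ * _).
  by apply: eq_card => l; rewrite !inE eq_sym.
- by rewrite expn_gt0.
- move=> u.
  have ball : #|[set v | e u v]| <= \sum_(S : {set 'I_L} | L <= t * #|S|)
      q ^ (L - #|S|).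
    rewrite -sum1_card (partition_big (agree u) (fun S => L <= t * #|S|)) /=; last first.
      by move=> v; rewrite inE.
    apply: leq_sum => S LS; rewrite -(card_ffun_fixed u) -sum1_card.
    rewrite [leqRHS]big_mkcond [leqLHS]big_mkcond; apply: leq_sum => v _ /=.
    rewrite !inE; case: ifP => // /andP[_ /eqP <-].
    suff -> : [forall l in agree u v, v l == u l] by [].
    by apply/forall_inP => l; rewrite inE eq_sym.
  have s2 : \sum_(S : {set 'I_L}) 1 = 2 ^ L.
    by rewrite sum1_card -cardsT -powersetT card_powerset cardsT card_ord.
  (* One factor [2 ^ L] clears the subtraction in the exponent, the second pays for the number of
     agreement sets. *)
  rewrite -(leq_pmul2r (m := 2 ^ L)) ?expn_gt0 // -expnD subnK ?leq_pmull ?muln_gt0 //.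
  rewrite -(leq_pmul2r (m := 2 ^ L)) ?expn_gt0 //.
  apply: (@leq_trans (2 ^ (2 * t * L) * \sum_(S : {set 'I_L} | L <= t * #|S|) 1)).
    apply: leq_trans (leq_mul (leq_mul ball (leqnn _)) (leqnn _)) _.
    rewrite -mulnA big_distrl big_distrr /=; apply: leq_sum => S LS.
    rewrite muln1 qE -expnM -!expnD leq_exp2l // mulnBr addnBAC; last first.
      by rewrite leq_mul2l -[leqRHS]card_ord max_card orbT.
    rewrite leq_subLR addnC leq_add2r addnn -mul2n -mulnA leq_mul2l.
    exact: LS.
  rewrite leq_mul2l -s2 [leqRHS](bigID (fun S : {set 'I_L} => L <= t * #|S|)) /=.
  by rewrite leq_addr orbT.
- by rewrite card_ffun !card_ord qE -expnM -expnD subnKC // leq_pmull // muln_gt0.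
by exists f => i j /fP; rewrite -ltnNge => /ltnW.
Qed.

(** The indices are cut into [M %/ q] blocks of length [q], and a word over [q] letters selects one
    index per block. Two such sets meet exactly in the blocks where their words agree. *)
Lemma packing (t : nat) : 0 < t -> exists2 q, 0 < q &
  forall M, 0 < M -> exists A : 'I_(2 ^ (M %/ q)) -> {set 'I_M},
    (forall m, M <= 2 * q * #|A m|) /\
    (forall m m', m != m' -> t * #|A m :&: A m'| <= #|A m|).
Proof.
move=> t0; exists (4 ^ t); first by rewrite expn_gt0.
move=> M M0; have q0 : 0 < 4 ^ t by rewrite expn_gt0.
have wex := fun L => words_rarely_agreeing L t0.
move: (4 ^ t) q0 wex => q q0 wex.
have [Mq|qM] := ltnP M q.
  (* With no complete block there is a single message, which takes all indices. *)
  rewrite divn_small //; exists (fun=> [set: 'I_M]); split=> [m|m m'].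
    by rewrite cardsT card_ord leq_pmull // muln_gt0.
  by rewrite !ord1 eqxx.
set L := M %/ q; have [w wP] := wex L.
have ltM m (l : 'I_L) : l * q + w m l < M.
  apply: (@leq_trans (l.+1 * q)); first by rewrite mulSn addnC ltn_add2r.
  apply: leq_trans (leq_trunc_div M q); rewrite leq_mul2r; apply/orP; right.
  exact: ltn_ord.
pose h m l := Ordinal (ltM m l).
have hdiv m l : h m l %/ q = l by rewrite /= divnMDl // divn_small ?addn0.
have h_inj m : injective (h m).
  by move=> l l' hl; apply: val_inj; rewrite /= -(hdiv m l) hl hdiv.
exists (fun m => h m @: [set: 'I_L]); split=> [m|m m' mm'].
  rewrite card_imset // cardsT card_ord.
  have L0 : 0 < L by rewrite divn_gt0.
  apply: ltnW; apply: leq_trans (ltn_ceil M q0) _; rewrite -/L.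
  by rewrite mulnC -mulnA mulnCA leq_mul2l mul2n -addnn -add1n leq_add2r L0 orbT.
rewrite [leqRHS]card_imset // cardsT card_ord; apply: leq_trans (wP _ _ mm').
rewrite leq_mul2l; apply/orP; right.
rewrite -(card_imset _ (h_inj m)); apply: subset_leq_card; apply/fintype.subsetP => i.
rewrite inE => /andP[/imsetP[l _ ->] /imsetP[l' _ hl]].
have ll : l = l' by apply: val_inj; rewrite /= -(hdiv m l) hl hdiv.
rewrite imset_f // inE; apply/eqP/val_inj.
by move/(congr1 val): hl; rewrite ll /= => /eqP; rewrite eqn_add2l => /eqP.
Qed.

End Packing.

(** * Identification by uniformly chosen codewords *)

Section UniformSubcodes.
Variable R : realType.

(** A push-forward of the uniform distribution: codewords may coincide and are counted with
    multiplicity. *)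
Definition unif_on (I X : finType) (A : {set I}) (f : I -> X) (x : X) : R :=
  #|A|%:R^-1 * \sum_(i in A) (f i == x)%:R.

Lemma unif_on_mean (I X : finType) (A : {set I}) (f : I -> X) (F : X -> R) :
  \sum_x unif_on A f x * F x = #|A|%:R^-1 * \sum_(i in A) F (f i).
Proof.
rewrite /unif_on; under eq_bigr do rewrite -mulrA mulr_suml.
rewrite -mulr_sumr exchange_big; congr (_ * _); apply: eq_bigr => i _ /=.
rewrite (bigD1 (f i)) //= eqxx mul1r big1 ?addr0 // => x /negPf xf.
by rewrite eq_sym xf mul0r.
Qed.

Lemma unif_on_distr (I X : finType) (A : {set I}) (f : I -> X) :
  (0 < #|A|)%N -> is_distr (unif_on A f).
Proof.
move=> A0; split=> [x|].
  by rewrite mulr_ge0 ?invr_ge0 ?ler0n // sumr_ge0.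
have := unif_on_mean A f (fun=> 1); under eq_bigr do rewrite mulr1.
by move=> ->; rewrite sumr_const mulVf // pnatr_eq0 -lt0n.
Qed.

Variables (X Y : finType) (d : nat).

Section Subcodes.
Variables (k M N M' N' : nat) (c : code R X Y d k M N).
Variables (A : 'I_M' -> {set 'I_M}) (B : 'I_N' -> {set 'I_N}).
Hypotheses (A0 : forall m, (0 < #|A m|)%N) (B0 : forall n, (0 < #|B n|)%N).

Definition subcode_test m n := \sum_(r in A m) \sum_(s in B n) dec c r s.

Lemma subcode_test_ge0 m n : op_le 0 (subcode_test m n).
Proof.
rewrite /op_le subr0 /subcode_test pair_big /=; apply: psd_sum => rs.
by case: (dec_povm c) => + _; apply.
Qed.

Lemma subcode_test_le1 m n : op_le (subcode_test m n) 1%:M.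
Proof.
have [pD <-] := dec_povm c; rewrite /op_le /subcode_test pair_big /=.
rewrite (bigID (fun rs => (rs.1 \in A m) && (rs.2 \in B n))) /= addrAC subrr add0r.
exact: psd_sum.
Qed.

Definition subcode_id : id_code R X Y d k M' N' :=
  IdCode (fun m => unif_on_distr (enc1 c) (A0 m))
    (fun n => unif_on_distr (enc2 c) (B0 n)) subcode_test_ge0 subcode_test_le1.

Lemma subcode_id_simultaneous : simultaneous subcode_id.
Proof. by exists M, N, (dec c), A, B; split=> //; exact: dec_povm. Qed.

Variable Wk : k.-tuple X -> k.-tuple Y -> state R (tdim d k).

Definition pair_error i j := 1 - prob (dec c i j) (Wk (enc1 c i) (enc2 c j)).

Definition rect_mean m n (F : 'I_M -> 'I_N -> R) :=
  #|A m|%:R^-1 * (#|B n|%:R^-1 * \sum_(i in A m) \sum_(j in B n) F i j).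

Lemma le_rect_mean m n F G :
  (forall i j, i \in A m -> j \in B n -> F i j <= G i j) ->
  rect_mean m n F <= rect_mean m n G.
Proof.
move=> FG; rewrite !ler_wpM2l ?invr_ge0 //.
by apply: ler_sum => i iA; apply: ler_sum => j jB; exact: FG.
Qed.

Lemma id_accept_subcode mn mn' : id_accept subcode_id Wk mn mn' =
  rect_mean mn.1 mn.2
    (fun i j => prob (subcode_test mn'.1 mn'.2) (Wk (enc1 c i) (enc2 c j))).
Proof.
rewrite /id_accept /= /rect_mean.
under eq_bigr => x _.
  under eq_bigr do rewrite -mulrA.
  rewrite -mulr_sumr unif_on_mean.
  over.
by rewrite unif_on_mean -mulr_sumr.
Qed.

Lemma dec_distr i j :
  is_distr (fun rs => prob (dec c rs.1 rs.2) (Wk (enc1 c i) (enc2 c j))).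
Proof. exact: povm_distr (dec_povm c). Qed.

Lemma pair_error_ge0 i j : 0 <= pair_error i j.
Proof.
have [p0 p1] := dec_distr i j.
rewrite /pair_error -[X in X - _]p1 (bigD1 (i, j)) //= addrAC subrr add0r.
exact: sumr_ge0.
Qed.

(** For a pair outside the rectangle, acceptance is a decoding error; for a pair inside, the trivial
    bound 1 is used. *)
Lemma prob_subcode_test_le m n i j :
  prob (subcode_test m n) (Wk (enc1 c i) (enc2 c j)) <=
  ((i \in A m) && (j \in B n))%:R + pair_error i j.
Proof.
have [p0 p1] := dec_distr i j.
rewrite /subcode_test pair_big /= prob_sum.
case: (boolP (_ && _)) => [_|nij].
  rewrite -[leLHS]addr0 lerD ?pair_error_ge0 // -[X in _ <= X]p1.
  by rewrite [leRHS](bigID (fun rs => (rs.1 \in A m) && (rs.2 \in B n))) /= lerDl sumr_ge0.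
rewrite add0r /pair_error -[X in _ <= X - _]p1 (bigD1 (i, j) (P := xpredT)) //=.
rewrite addrAC subrr add0r big_mkcond [leRHS]big_mkcond; apply: ler_sum => rs _.
case: ifP => [rsAB|_]; last by case: ifP.
by rewrite ifT //; apply: contraNN nij => /eqP rE; rewrite rE in rsAB.
Qed.

Lemma prob_subcode_test_ge m n i j : i \in A m -> j \in B n ->
  1 - prob (subcode_test m n) (Wk (enc1 c i) (enc2 c j)) <= pair_error i j.
Proof.
have [p0 p1] := dec_distr i j => iA jB.
rewrite lerD2l lerN2 /subcode_test pair_big /= prob_sum.
by rewrite (bigD1 (i, j)) /= ?iA // lerDl sumr_ge0.
Qed.

(** Pair errors are nonnegative and the rectangle holds at least the fraction [q ^- 2] of all pairs,
    so averaging over it loses at most [q ^+ 2]. *)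
Lemma rect_mean_pair_error (q : nat) m n :
  (0 < M)%N -> (0 < N)%N ->
  (M <= q * #|A m|)%N -> (N <= q * #|B n|)%N ->
  rect_mean m n pair_error <= q%:R ^+ 2 * avg_error c Wk.
Proof.
move=> M0 N0 MA NB.
have -> : avg_error c Wk = (M%:R * N%:R)^-1 * \sum_i \sum_j pair_error i j.
  rewrite /pair_error.
  under [X in _ * X]eq_bigr do rewrite sumrB sumr_const card_ord.
  rewrite sumrB sumr_const card_ord -mulrnA mulnC natrM mulrBr mulVf //.
  by rewrite mulf_neq0 // pnatr_eq0 -lt0n.
set S := \sum_i \sum_j _.
have S0 : 0 <= S.
  by apply: sumr_ge0 => i _; apply: sumr_ge0 => j _; exact: pair_error_ge0.
have le_S : \sum_(i in A m) \sum_(j in B n) pair_error i j <= S.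
  rewrite /S !pair_big /= big_mkcond /=; apply: ler_sum => ij _.
  by case: ifP => // _; exact: pair_error_ge0.
have a0 : 0 < #|A m|%:R :> R by rewrite ltr0n.
have b0 : 0 < #|B n|%:R :> R by rewrite ltr0n.
have M0' : 0 < M%:R :> R by rewrite ltr0n.
have N0' : 0 < N%:R :> R by rewrite ltr0n.
apply: (@le_trans _ _ (#|A m|%:R^-1 * (#|B n|%:R^-1 * S))).
  by rewrite !ler_wpM2l ?invr_ge0 // ltW.
rewrite mulrA [leRHS]mulrA; apply: ler_wpM2r => //.
have le_inv (a n' : nat) : (0 < a)%N -> (0 < n')%N -> (n' <= q * a)%N ->
    a%:R^-1 <= q%:R / n'%:R :> R.
  move=> a_gt0 n_gt0 le_n; rewrite ler_pdivlMr ?ltr0n // mulrC.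
  by rewrite ler_pdivrMr ?ltr0n // -natrM ler_nat.
have -> : q%:R ^+ 2 * (M%:R * N%:R)^-1 = q%:R / M%:R * (q%:R / N%:R) :> R.
  by field; rewrite !gt_eqF.
by rewrite ler_pM ?invr_ge0 ?le_inv.
Qed.

End Subcodes.

End UniformSubcodes.

Section Direct.
Variables (R : realType) (X Y : finType) (d : nat).

(** A false acceptance is either a decoding error or an index pair in both rectangles. The latter
    has the product of two overlap fractions as probability; distinct message pairs make one of them
    at most [1 / t]. *)
Lemma code_to_sim_id_code (t q k M N : nat) (M' N' : nat) (c : code R X Y d k M N)
    (Wk : k.-tuple X -> k.-tuple Y -> state R (tdim d k))
    (A : 'I_M' -> {set 'I_M}) (B : 'I_N' -> {set 'I_N}) (eps : R) :
  (0 < t)%N -> (0 < M)%N -> (0 < N)%N ->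
  (forall m, M <= q * #|A m|)%N -> (forall n, N <= q * #|B n|)%N ->
  (forall m m', m != m' -> t * #|A m :&: A m'| <= #|A m|)%N ->
  (forall n n', n != n' -> t * #|B n :&: B n'| <= #|B n|)%N ->
  q%:R ^+ 2 * avg_error c Wk <= eps -> 0 <= eps ->
  exists c' : id_code R X Y d k M' N', simultaneous c' /\
    id_error1 c' Wk <= eps /\ id_error2 c' Wk <= t%:R^-1 + eps.
Proof.
move=> t0 M0 N0 MA NB AA BB err eps0.
have A0 m : (0 < #|A m|)%N.
  by rewrite lt0n; apply: contraTneq (MA m) => ->; rewrite muln0 -ltnNge.
have B0 n : (0 < #|B n|)%N.
  by rewrite lt0n; apply: contraTneq (NB n) => ->; rewrite muln0 -ltnNge.
exists (subcode_id c A0 B0); split; first exact: subcode_id_simultaneous.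
have mean_err m n : rect_mean A B m n (pair_error c Wk) <= eps.
  exact: le_trans (rect_mean_pair_error c A0 B0 Wk M0 N0 (MA m) (NB n)) err.
have mean1 m n : rect_mean A B m n (fun _ _ => 1) = 1 :> R.
  rewrite /rect_mean; under eq_bigr do rewrite sumr_const.
  rewrite sumr_const -[_ *+ #|A m|]mulr_natl; field.
  by rewrite !pnatr_eq0 -!lt0n A0 B0.
have meanD m n F G : rect_mean A B m n (fun i j => F i j + G i j) =
    rect_mean A B m n F + rect_mean A B m n G :> R.
  rewrite /rect_mean -!mulrDr -big_split; do 2!congr (_ * _).
  by apply: eq_bigr => i _; rewrite big_split.
have meanN m n F : rect_mean A B m n (fun i j => - F i j) =
    - rect_mean A B m n F :> R.
  rewrite /rect_mean; under eq_bigr do rewrite sumrN.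
  by rewrite sumrN !mulrN.
split.
  apply: bigmax_le => // -[m n] _; rewrite id_accept_subcode /=.
  rewrite -(mean1 m n) -meanN -meanD; apply: le_trans (mean_err m n).
  by apply: le_rect_mean => i j; exact: prob_subcode_test_ge.
have t1 : 0 <= t%:R^-1 :> R by rewrite invr_ge0.
apply: bigmax_le => [|[[m n] [m' n']] /= neq]; first exact: addr_ge0.
rewrite id_accept_subcode /=.
apply: (@le_trans _ _ (rect_mean A B m n (fun i j =>
    ((i \in A m') && (j \in B n'))%:R + pair_error c Wk i j))).
  by apply: le_rect_mean => i j _ _; exact: prob_subcode_test_le.
rewrite meanD lerD //.
have sum_mem (I : finType) (C C' : {set I}) :
    \sum_(i in C) (i \in C')%:R = #|C :&: C'|%:R :> R.
  rewrite -sum1_card natr_sum big_mkcond [RHS]big_mkcond; apply: eq_bigr => i _.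
  by rewrite inE; case: (i \in C) => //; case: (i \in C').
have -> : rect_mean A B m n (fun i j => ((i \in A m') && (j \in B n'))%:R) =
    #|A m :&: A m'|%:R / #|A m|%:R * (#|B n :&: B n'|%:R / #|B n|%:R) :> R.
  rewrite /rect_mean.
  have -> : \sum_(i in A m) \sum_(j in B n) ((i \in A m') && (j \in B n'))%:R =
      #|A m :&: A m'|%:R * #|B n :&: B n'|%:R :> R.
    rewrite -!sum_mem big_distrlr; apply: eq_bigr => i _; apply: eq_bigr => j _.
    by rewrite -mulnb natrM.
  by field; rewrite !pnatr_eq0 -!lt0n A0 B0.
have frac_le1 (I : finType) (C C' : {set I}) : (0 < #|C|)%N ->
    0 <= (#|C :&: C'|%:R / #|C|%:R : R) <= 1.
  move=> C0; rewrite divr_ge0 // ler_pdivrMr ?ltr0n // mul1r ler_nat.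
  by rewrite subset_leq_card // finset.subsetIl.
have frac_let (I : finType) (C C' : {set I}) : (0 < #|C|)%N ->
    (t * #|C :&: C'| <= #|C|)%N -> #|C :&: C'|%:R / #|C|%:R <= t%:R^-1 :> R.
  move=> C0 le_t; rewrite ler_pdivrMr ?ltr0n // mulrC ler_pdivlMr ?ltr0n //.
  by rewrite mulrC -natrM ler_nat.
have /andP[fA0 fA1] := frac_le1 _ (A m) (A m') (A0 m).
have /andP[fB0 fB1] := frac_le1 _ (B n) (B n') (B0 n).
move: neq; rewrite xpair_eqE negb_and => /orP[mm'|nn'].
  rewrite -[leRHS]mulr1 ler_pM //; apply: frac_let => //; exact: AA.
rewrite -[leRHS]mul1r ler_pM //; apply: frac_let => //; exact: BB.
Qed.

(** The inner logarithm equals [M %/ q], so only the constant [q] is lost, and the slack [delta / 2]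
    absorbs it for large [k]. *)
Lemma id_rate (r delta : R) (q : nat) : 0 < delta ->
  exists k0 : nat, forall k : nat, (k0 <= k)%N -> forall M : nat, (0 < M)%N ->
  (0 < q)%N -> k%:R^-1 * log2 M%:R >= r - delta / 2 ->
  k%:R^-1 * log2 (log2 (2 ^ (M %/ q))%:R) >= r - delta :> R.
Proof.
move=> d0; have l2 := ln2_gt0 R.
have [k0 k0P] := @linear_le_expR R (2 * q%:R) (delta / 2 * ln 2)
  (mulr_gt0 (divr_gt0 d0 (ltr0Sn _ 1)) l2).
exists k0.+1 => k kk M M0 q0 hM.
have kpos : 0 < k%:R :> R by rewrite ltr0n; exact: leq_trans kk.
set L := (M %/ q)%N.
have -> : log2 (2 ^ L)%:R = L%:R :> R.
  by rewrite /log2 natrX lnXn // -[ln 2 *+ L]mulr_natl mulfK ?gt_eqF.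
have [r0|r0] := leP (r - delta) 0.
  apply: le_trans r0 _; rewrite mulr_ge0 ?invr_ge0 ?(ltW kpos) //.
  rewrite /log2 divr_ge0 ?(ltW l2) //.
  (* For [L = 0] the convention [ln 0 = 0] gives the single message rate 0. *)
  by case: L => [|L]; [rewrite ln0 | rewrite ln_ge0 // ler1n].
pose E : R := expR (k%:R * (r - delta) * ln 2).
have E1 : 1 <= E.
  by rewrite (le_trans _ (expR_ge1Dx _)) // lerDl !mulr_ge0 // ltW.
rewrite ler_pdivlMl //; apply: log2_ge.
have lM : expR (k%:R * (r - delta / 2) * ln 2) <= M%:R.
  by apply: log2_le; rewrite ?ltr0n // -ler_pdivlMl.
have EM : E * (2 * q%:R) <= M%:R.
  apply: le_trans lM.
  have -> : k%:R * (r - delta / 2) * ln 2 =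
     k%:R * (r - delta) * ln 2 + k%:R * (delta / 2 * ln 2) by field.
  rewrite expRD -/E ler_wpM2l ?expR_ge0 //.
  apply: le_trans (k0P k (ltnW kk)); rewrite -[leLHS]mulr1 ler_wpM2l ?mulr_ge0 //.
  by rewrite ler1n; exact: leq_trans kk.
have qR : 0 < q%:R :> R by rewrite ltr0n.
(* Together with [EM] this gives [2 * E <= L + 1], and [1 <= E] removes the rounding term. *)
have : M%:R <= q%:R * (L%:R + 1) :> R.
  by rewrite natr1 -natrM ler_nat mulnC ltnW // ltn_ceil.
move=> /(le_trans EM); rewrite mulrA [leLHS]mulrC ler_pM2l //.
rewrite -/E; nra.
Qed.

Lemma achievable_sim_id_achievable (W : ccq_channel R X Y d) (r : R * R) :
  achievable W r -> sim_id_achievable W r.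
Proof.
move=> hW eps1 eps2 delta e1 e2 d0.
pose eps := Num.min eps1 eps2; have eps0 : 0 < eps by rewrite lt_min e1.
pose t := (Num.trunc (2 / eps)).+1.
have te : t%:R^-1 <= eps / 2.
  have /andP[_ lt_t] := truncn_itv (ltW (divr_gt0 (ltr0Sn R 1) eps0)).
  rewrite -[leRHS]invrK lef_pV2 ?posrE ?ltr0n ?invr_gt0 ?divr_gt0 //.
  by rewrite invf_div ltW.
have [q q0 qP] := packing (ltn0Sn (Num.trunc (2 / eps))).
have t0 : (0 < t)%N by [].
rewrite -/t in qP; clearbody t.
(* The other half of [eps] is spent on overlaps through [t]. As [q] depends only on [t], the
   transmission error can be chosen after it. *)
pose e0 := eps / 2 / (2 * q)%:R ^+ 2.
have Q0 : 0 < (2 * q)%:R :> R by rewrite ltr0n muln_gt0.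
have e00 : 0 < e0 by rewrite !divr_gt0 // exprn_gt0.
have [k1 k1P] := hW _ _ e00 (divr_gt0 d0 (ltr0Sn R 1)).
have [k2 k2P] := id_rate r.1 q d0.
have [k3 k3P] := id_rate r.2 q d0.
exists (maxn k1 (maxn k2 k3)) => k; rewrite !geq_max => /and3P[kk1 kk2 kk3].
have [M [N [M0 N0 [c [r1 r2 err]]]]] := k1P k kk1.
have [A [MA AA]] := qP _ M0; have [B [NB BB]] := qP _ N0.
exists (2 ^ (M %/ q))%N, (2 ^ (N %/ q))%N; rewrite !expn_gt0; split=> //.
have err' : (2 * q)%:R ^+ 2 * avg_error c (W k) <= eps / 2.
  by rewrite mulrC -ler_pdivlMr ?exprn_gt0.
have [c' [sc [er1 er2]]] := code_to_sim_id_code t0 M0 N0 MA NB AA BB err'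
  (ltW (divr_gt0 eps0 (ltr0Sn R 1))).
have [l1 l2] : eps <= eps1 /\ eps <= eps2.
  by rewrite /eps !ge_min !lexx orbT.
exists c'; split=> //; split; [exact: k2P | exact: k3P | lra | lra].
Qed.

End Direct.
Theorem theorem4p7 (R : realType) (X Y : finType) (d : nat)
    (W : X -> Y -> state R d) :
  capacity_region (dm_ccq W) = sim_id_capacity_region (dm_ccq W).
Proof.
apply/seteqP; split=> r [r1 r2 h]; split=> //.
  exact: achievable_sim_id_achievable.
exact: sim_id_achievable_achievable.
Qed.
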